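(* Let $n\ge2$, let $P=(P_1,\ldots,P_n)$ be an admissible polynomial $n$-tuple and let $m=(m_1,\ldots,m_n)\in\mathbb N^n$. Then the Taylor spectrum of $\mathscr M_z$ on $\mathscr H^2_m(\triangle^n_P)$ is equal to $\overline{\triangle^n_{P_{\mathbf r}}}$, where $\mathbf r=(r_1,\ldots,r_n)$ is given by $$r_j=\lim_{\ell\to\infty}\ \sup_{k\ge0}\Bigg(\frac{\sqrt{A_{\widetilde P_j,m_j}(k)}}{\sqrt{A_{\widetilde P_j,m_j}(k+\ell)}}\Bigg)^{1/\ell},\qquad j=1,\ldots,n.$$ Moreover, $r_j\le\frac1{\sqrt{\partial_jP_j(0)}}$ for $j=1,\ldots,n$.
   Context: $\mathbb N$ = positive integers, $\mathbb C_*=\mathbb C\setminus\{0\}$, $\varepsilon_j$ = $j$-th standard basis vector, $z\diamond w=(z_1w_1,\ldots,z_nw_n)$, $\overline z$ = entrywise conjugate of points; $\overline{\triangle^n_{P_{\mathbf r}}}$ denotes closure in $\mathbb C^n$. An admissible polynomial $n$-tuple is $P=(P_1,\ldots,P_n)$ in $\mathbb C[z_1,\ldots,z_n]$ such that each $P_j$ has nonnegative coefficients, zero constant term, linear part $a_jz_j$ with $a_j>0$, and depends on the variable $z_j$ alone. Put $\widetilde P_j(s)=P_j(s\varepsilon_j)$, $s\in\mathbb C$, and define $A_{\widetilde P_j,m_j}(k)>0$, $k\ge0$, by $(1-\widetilde P_j(s))^{-m_j}=\sum_{k\ge0}A_{\widetilde P_j,m_j}(k)s^k$ near $0$. Let $\varphi(z)=\big(\frac{z_1}{z_2},\ldots,\frac{z_{n-1}}{z_n},z_n\big)$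 on $\mathbb C\times\mathbb C_*^{n-1}$, and $\triangle^n_P=\{z\in\mathbb C\times\mathbb C_*^{n-1}:P_j(\varphi(z)\diamond\overline{\varphi(z)})<1,\ j=1,\ldots,n\}$. For an $n$-tuple $\mathbf r$ of positive reals, $P_{\mathbf r}=(z_1/r_1^2,\ldots,z_n/r_n^2)$, so that $$\triangle^n_{P_{\mathbf r}}=\{z\in\mathbb C\times\mathbb C_*^{n-1}:|z_j|<r_j|z_{j+1}|,\ j=1,\ldots,n-1,\ |z_n|<r_n\}.$$ $\mathscr H^2_m(\triangle^n_P)$ is the reproducing kernel Hilbert space of holomorphic functions on $\triangle^n_P$ with kernel $$\mathscr K_{P,m}(z,w)=\prod_{j=2}^n\frac1{z_j\overline w_j}\prod_{j=1}^n\frac1{\big(1-P_j(\varphi(z)\diamond\overline{\varphi(w)})\big)^{m_j}}.$$ Each $z_j$ is a multiplier of this space; $\mathscr M_{z_j}$ is the bounded operator of multiplication by $z_j$, and $\mathscr M_z=(\mathscr M_{z_1},\ldots,\mathscr M_{z_n})$. *)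

(* Defs.v *)
(* The complex numbers are R[i], for R : realType. *)
From HB Require Import structures.
From mathcomp Require Import all_boot all_order all_algebra.
From mathcomp Require Import all_classical all_reals all_analysis.
From mathcomp Require Import complex.
(* The notations of mpoly and those of MathComp-Analysis cannot be loaded together. *)
From mathcomp Require mpoly.

Set Implicit Arguments.
Unset Strict Implicit.
Unset Printing Implicit Defensive.

Export (canonicals, coercions) mpoly.
Import Order.TTheory GRing.Theory Num.Theory.
Import numFieldNormedType.Exports.
Local Open Scope classical_set_scope.
Local Open Scope ring_scope.
Local Open Scope complex_scope.

(* The usual topology and norm of the complex numbers, as for any numFieldType. *)
HB.instance Definition _ (R : realType) := PseudoPointedMetric.copy R[i] R[i]^o.
HB.instance Definition _ (R : realType) := GRing.ComAlgebra.copy R[i] R[i]^o.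
HB.instance Definition _ (R : realType) := Vector.copy R[i] R[i]^o.
HB.instance Definition _ (R : realType) := NormedModule.copy R[i] R[i]^o.

Section Triangle.
Context {R : realType} {n : nat}.
Implicit Types (z w : 'rV[R[i]]_n) (P : 'I_n -> mpoly.mpoly n R[i]).

Definition peval (p : mpoly.mpoly n R[i]) z : R[i] := mpoly.meval (z 0) p.

Definition admissible P :=
  forall j : 'I_n,
  [/\ forall k : mpoly.multinom n, 0 <= mpoly.mcoeff k (P j),
      mpoly.mcoeff mpoly.mnm0 (P j) = 0,
      exists2 a : R[i], 0 < a &
        forall i : 'I_n, mpoly.mcoeff (mpoly.mnm1 i) (P j) = a *+ (i == j)
    & forall k : mpoly.multinom n, mpoly.mcoeff k (P j) != 0 ->
        forall i : 'I_n, i != j -> k i = 0%N].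

Definition conj_vec z : 'rV[R[i]]_n := map_mx Num.conj z.

Definition diamond z w : 'rV[R[i]]_n := map2_mx *%R z w.

(* The entry that follows z_j, and 1 after the last one. *)
Definition next_coord z (j : 'I_n) : R[i] :=
  if (insub j.+1 : option 'I_n) is Some k then z 0 k else 1.

Definition phi z : 'rV[R[i]]_n := \row_j (z 0 j / next_coord z j).

Definition triangle P : set 'rV[R[i]]_n :=
  [set z : 'rV[R[i]]_n | (forall j : 'I_n, (0 < j)%N -> z 0 j != 0) /\
           (forall j : 'I_n,
              peval (P j) (diamond (phi z) (conj_vec (phi z))) < 1)].

Definition triangle_kernel P (m : 'I_n -> nat) z w : R[i] :=
  (\prod_(j < n | (0 < j)%N) (z 0 j * Num.conj (w 0 j))^-1) *
  \prod_(j < n) (1 - peval (P j) (diamond (phi z) (conj_vec (phi w)))) ^- m j.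

Definition Pr (r : 'I_n -> R) (j : 'I_n) : mpoly.mpoly n R[i] :=
  ((r j ^+ 2)^-1)%:C *: mpoly.mpolyX R[i] (mpoly.mnm1 j).

End Triangle.

Definition holomorphic_on (R : realType) (n : nat) (Omega : set 'rV[R[i]]_n)
    (f : 'rV[R[i]]_n -> R[i]) :=
  forall z, Omega z -> differentiable f z.

(* The Hilbert space of holomorphic functions on Omega with reproducing kernel
   K.  An element f of the space is the function [fun_of f], whose values
   outside Omega are irrelevant; that the vector space operations are the
   pointwise ones on Omega follows from [reproducing].  The space is determined
   by Omega and K up to an isometry that preserves the functions on Omega. *)
Record rkhs (R : realType) (n : nat) (Omega : set 'rV[R[i]]_n)
    (K : 'rV[R[i]]_n -> 'rV[R[i]]_n -> R[i]) := Rkhs {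
  space :> completeNormedModType R[i];
  inner : {dot space for Num.conj};
  inner_norm : forall f : space, inner f f = `|f| ^+ 2;
  fun_of : space -> 'rV[R[i]]_n -> R[i];
  fun_of_inj : forall f g : space,
    (forall z, Omega z -> fun_of f z = fun_of g z) -> f = g;
  fun_of_holo : forall f : space, holomorphic_on Omega (fun_of f);
  kernel_at : 'rV[R[i]]_n -> space;
  kernel_atE : forall z w, Omega z -> Omega w -> fun_of (kernel_at w) z = K z w;
  reproducing : forall (f : space) w, Omega w ->
    inner f (kernel_at w) = fun_of f w
}.

(* Multiplication by g; the default 0 only matters when g is not a multiplier. *)
Definition mult_op (R : realType) (n : nat) (Omega : set 'rV[R[i]]_n)
    (K : 'rV[R[i]]_n -> 'rV[R[i]]_n -> R[i]) (H : rkhs Omega K)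
    (g : 'rV[R[i]]_n -> R[i]) (f : H) : H :=
  xget 0 [set h : H | forall z, Omega z -> fun_of h z = g z * fun_of f z].
Arguments mult_op {R n Omega K} H g f.

Definition Mz (R : realType) (n : nat) (Omega : set 'rV[R[i]]_n)
    (K : 'rV[R[i]]_n -> 'rV[R[i]]_n -> R[i]) (H : rkhs Omega K)
    (j : 'I_n) : H -> H :=
  mult_op H (fun z => z 0 j).
Arguments Mz {R n Omega K} H j.

Section TaylorSpectrum.
Context {F : fieldType} {H : lmodType F} {n : nat}.
Implicit Types T : 'I_n -> H -> H.

(* H (x) Lambda(F^n): the value at S is the coefficient of the wedge product of
   the e_j, j in S, in increasing order.  The Koszul differential is the sum
   over i of T_i (x) (e_i /\ _). *)
Definition koszul T (c : {ffun {set 'I_n} -> H}) : {ffun {set 'I_n} -> H} :=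
  [ffun S : {set 'I_n} =>
     \sum_(i in S) (-1) ^+ #|[set j in S | (j < i)%N]| *: T i (c (S :\ i))].

Definition koszul_exact T :=
  [set c | koszul T c = 0] = range (koszul T).

(* T is meant to be a tuple of commuting bounded operators. *)
Definition taylor_spectrum T : set 'rV[F]_n :=
  [set lambda | ~ koszul_exact (fun i x => T i x - lambda 0 i *: x)].

End TaylorSpectrum.

Definition power_series_at0 (R : realType) (f : R[i] -> R[i]) (a : nat -> R) :=
  \forall s \near (0 : R[i]), series (fun k => (a k)%:C * s ^+ k) @ \oo --> f s.

Definition ptilde (R : realType) (n : nat) (P : 'I_n -> mpoly.mpoly n R[i])
    (j : 'I_n) (s : R[i]) : R[i] :=
  peval (P j) (s *: delta_mx 0 j).

(* An extended real, as the supremum could a priori be infinite. *)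
Definition ratio_sup (R : realType) (a : nat -> R) (l : nat) : \bar R :=
  ereal_sup (range (fun k : nat =>
    ((Num.sqrt (a k) / Num.sqrt (a (k + l)%N)) `^ l%:R^-1)%:E)).

(* Main.v *)
(* Write phi_j = z_j / z_(j+1), so that z_j = phi_j ... phi_n.  In these coordinates
   the kernel is, up to the factor prod_(j >= 2) 1 / (z_j conj w_j), the product of the
   one-variable kernels sum_k A_j(k) (phi_j(z) conj phi_j(w))^k, and M_(phi_j) is a
   weighted shift in the j-th direction.

   Let s_j > 0 be the root of P_j(s) = 1.  The coefficients A_j satisfy a renewal
   equation, which yields A_j(k) <= c s_j^l A_j(k + l) for all k and l; as
   sum_k A_j(k) s^k converges for s < s_j, it follows that r_j^2 = s_j.  In
   particular triangle P = triangle (Pr r).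

   If lam is not in the closure, then |lam_j| > r_j |lam_(j+1)| for some j
   (lam_(n+1) = 1), and (lam_(j+1) phi_j - lam_j)^-1 is a multiplier g by a Neumann
   series.  Now g (z_j - lam_j) - g phi_j (z_(j+1) - lam_(j+1)) = 1 is a Bezout
   identity, which makes the Koszul complex exact.

   If lam is in the closure, then the ranges of the M_(z_i) - lam_i do not span the
   space: otherwise every g would be O(|w - lam| |k_w|) as w tends to lam, which
   fails for a suitable series of kernel functions. *)

Require Import Defs.
From HB Require Import structures.
From mathcomp Require Import all_boot all_order all_algebra.
From mathcomp Require Import all_classical all_reals all_analysis.
From mathcomp Require Import complex ring lra.
From mathcomp Require mpoly.
Import Order.TTheory GRing.Theory Num.Theory.
Import numFieldNormedType.Exports.
Local Open Scope classical_set_scope.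
Local Open Scope ring_scope.
Local Open Scope complex_scope.

Set Implicit Arguments.
Unset Strict Implicit.
Unset Printing Implicit Defensive.

(** * Complex sequences and uniqueness of power series *)

Section ComplexLimits.
Context {R : realType}.

Lemma normC_Re (V : normedModType R[i]) (x : V) : `|x| = (complex.Re `|x|)%:C.
Proof. by rewrite RRe_real// normr_real. Qed.

Lemma Re_norm_ge0 (V : normedModType R[i]) (x : V) : 0 <= complex.Re `|x|.
Proof. by rewrite -ler0c -normC_Re. Qed.

Lemma normC_realE (x : R[i]) : exists2 a : R, 0 <= a & `|x| = a%:C.
Proof.
exists (complex.Re `|x|); last by rewrite RRe_real// normr_real.
by rewrite -ler0c RRe_real// normr_real.
Qed.

(** Norms take values in [R[i]], whose order is only partial; passing to real parts gives access to
    the squeeze and limit lemmas for real sequences. *)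
Lemma cvg_Re_norm (V : normedModType R[i]) (u : nat -> V) (l : V) :
  u @ \oo --> l <-> (fun n => complex.Re `|l - u n|) @ \oo --> (0 : R).
Proof.
split=> [/cvgrPdist_lt ul|/cvgrPdist_lt ul].
  apply/cvgrPdist_lt => e e0.
  have e0' : 0 < e%:C by rewrite ltcR.
  near=> n; rewrite sub0r normrN ger0_norm ?Re_norm_ge0//.
  rewrite -ltcR -normC_Re; near: n; exact: ul e0'.
apply/cvgrPdist_lt => e e0.
have [r er] : exists r, e = r%:C by exists (complex.Re e); rewrite RRe_real// gtr0_real.
move: e0; rewrite er ltcR => r0.
apply: filterS (ul _ r0) => n; rewrite sub0r normrN normC_Re ltcR.
exact: le_lt_trans (ler_norm _).
Unshelve. all: by end_near. Qed.

Lemma cvg_norm_le (V : normedModType R[i]) (u : nat -> V) (l : V) (e : nat -> R) :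
  (forall n, `|l - u n| <= (e n)%:C) -> e @ \oo --> 0 -> u @ \oo --> l.
Proof.
move=> ue e0; apply/cvg_Re_norm; apply: squeeze_cvgr; last exact: e0; last first.
  exact: cvg_cst.
near=> n; rewrite Re_norm_ge0/= -lecR -normC_Re; exact: ue.
Unshelve. all: by end_near. Qed.

Lemma cvg_Re (u : nat -> R[i]) (l : R[i]) :
  u @ \oo --> l -> (fun n => complex.Re (u n)) @ \oo --> complex.Re l.
Proof.
move=> /cvgrPdist_lt ul; apply/cvgrPdist_lt => e e0.
have e0' : 0 < e%:C by rewrite ltcR.
apply: filterS (ul _ e0') => n; rewrite /= -raddfB -ltcR.
exact: le_lt_trans (normc_ge_Re _).
Qed.

End ComplexLimits.

Lemma cvg_sum0 (K : numFieldType) n (u : nat -> nat -> K) :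
  (forall i, (i < n)%N -> u i @ \oo --> 0) ->
  (fun N => \sum_(i < n) u i N) @ \oo --> 0.
Proof.
elim: n => [|n IH] u0.
  by rewrite (_ : (fun N => _) = fun=> 0); [exact: cvg_cst|apply/funext => N;
    rewrite big_ord0].
rewrite (_ : (fun N => _) = fun N => \sum_(i < n) u i N + u n N); last first.
  by apply/funext => N; rewrite big_ord_recr.
by rewrite -[X in _ --> X]addr0; apply: cvgD; [apply: IH => i iN|]; apply: u0;
  rewrite ?ltnS// ltnW.
Qed.

Section PowerSeriesUniqueness.
Context {R : realType}.

Lemma sum_expr_le2 (t : R) N : 0 <= t -> t <= 2^-1 -> \sum_(i < N) t ^+ i <= 2.
Proof.
move=> t0 t2; elim: N => [|N IH]; first by rewrite big_ord0.
rewrite big_ord_recl expr0; under eq_bigr do rewrite exprS.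
rewrite -mulr_sumr; have : t * \sum_(i < N) t ^+ i <= 2^-1 * 2.
  by rewrite ler_pM// sumr_ge0// => i _; rewrite exprn_ge0.
by rewrite mulVf// => h; rewrite -[leRHS]/(1 + 1) lerD2l.
Qed.

(** Strong induction on [k]: once the lower coefficients vanish, the value 0 of the sum at [e * t]
    bounds the term of degree [k] by the tail, which is at most [2 * M * t ^+ k.+1]. Dividing by
    [t ^+ k] and letting [t] tend to 0 gives the claim. *)
Lemma power_series_eq0 (a : nat -> R) (e : R) : 0 < e ->
  (forall t, 0 < t -> t <= e -> series (fun k => a k * t ^+ k) @ \oo --> (0 : R)) ->
  forall k, a k = 0.
Proof.
move=> e0 Sa.
have [M [M0 aM]] : exists M, 0 <= M /\ forall k, `|a k| * e ^+ k <= M.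
  have /cvgP/cvg_series_cvg_0/cvgP/cvg_seq_bounded := Sa e e0 (lexx e).
  move=> /pinfty_ex_gt0[M M0 h]; exists M; split; first exact: ltW.
  by move=> k; have /= := h k I; rewrite normrM (ger0_norm (exprn_ge0 k (ltW e0))).
elim/ltn_ind => k IH.
suff H t : 0 < t -> t <= 2^-1 -> `|a k| * e ^+ k <= 2 * M * t.
  have h : `|a k| * e ^+ k <= 0.
    apply/ler_addgt0Pr => d d0; rewrite add0r.
    (* The summand 1 keeps the quotient meaningful when [M = 0]; the minimum keeps [t] where the
       geometric sums are at most 2. *)
    pose t := Num.min 2^-1 (d / (2 * M + 1)).
    have M1 : 0 < 2 * M + 1 by rewrite ltr_wpDl// mulr_ge0.
    have t0 : 0 < t by rewrite lt_min invr_gt0 ltr0n divr_gt0.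
    apply: le_trans (H t t0 _) _; first by rewrite ge_min lexx.
    apply: (@le_trans _ _ ((2 * M + 1) * t)); first by rewrite ler_wpM2r ?(ltW t0)//
      lerDl.
    by rewrite mulrC -ler_pdivlMr// ge_min lexx orbT.
  apply/eqP; rewrite -normr_le0 -(pmulr_lle0 _ (exprn_gt0 k e0)) mulrC.
  by rewrite mulrC.
move=> t0 t2; set u := fun k => a k * (e * t) ^+ k.
have et0 : 0 < e * t by rewrite mulr_gt0.
have ete : e * t <= e by rewrite ger_pMr// (le_trans t2)// invf_le1// ler1n.
have Su : series u @ \oo --> (0 : R) by exact: Sa.
have uE n : series u (n + k.+1)%N = u k + \sum_(i < n) u (k.+1 + i)%N.
  rewrite seriesEnat/= big_mkord addnC big_split_ord/= big_ord_recr/= big1 ?add0r//.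
  by move=> i _; rewrite /u IH// mul0r.
have tail n : `|\sum_(i < n) u (k.+1 + i)%N| <= 2 * M * t ^+ k.+1.
  apply: le_trans (ler_norm_sum _ _ _) _.
  apply: (@le_trans _ _ (\sum_(i < n) M * t ^+ k.+1 * t ^+ i)).
    apply: ler_sum => i _; rewrite normrM exprMn [`|_ * _ ^+ _|]ger0_norm; last first.
      by rewrite mulr_ge0 ?exprn_ge0 ?(ltW t0) ?(ltW e0).
    by rewrite mulrA -[leRHS]mulrA -exprD ler_wpM2r ?exprn_ge0 ?(ltW t0).
  rewrite -mulr_sumr mulrC -mulrA ler_wpM2r ?mulr_ge0 ?exprn_ge0 ?(ltW t0)//.
  exact: sum_expr_le2 (ltW t0) t2.
have ukle n : `|u k| - 2 * M * t ^+ k.+1 <= `|series u (n + k.+1)%N|.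
  rewrite uE; apply: le_trans (lerB_normD _ _); by rewrite lerD2l lerN2.
have : `|u k| - 2 * M * t ^+ k.+1 <= 0.
  have c0 : (fun n => `|series u (n + k.+1)%N|) @ \oo --> (0 : R).
    by rewrite -[X in _ --> X](@normr0 R R); apply: cvg_norm; rewrite cvg_shiftn.
  have <- := cvg_lim (@Rhausdorff R) c0.
  by apply: limr_ge; [exact: cvgP c0|near=> n].
rewrite subr_le0 normrM exprMn [`|_ * _ ^+ _|]ger0_norm; last first.
  by rewrite mulr_ge0 ?exprn_ge0 ?(ltW t0) ?(ltW e0).
by rewrite mulrA exprS mulrA ler_pM2r ?exprn_gt0.
Unshelve. all: by end_near. Qed.

(** Real parts at small positive reals reduce the claim to [power_series_eq0]. This identifies the
    given [A j] with explicitly computed coefficients. *)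
Lemma power_series_at0_unique (f : R[i] -> R[i]) (a b : nat -> R) :
  power_series_at0 f a -> power_series_at0 f b -> a = b.
Proof.
move=> fa fb; have [e e0 fe] : exists2 e : R, 0 < e & forall s : R[i], `|s| <= e%:C ->
    series (fun k => (a k)%:C * s ^+ k) @ \oo --> f s /\
    series (fun k => (b k)%:C * s ^+ k) @ \oo --> f s.
  have : \forall s \near (0 : R[i]),
      series (fun k => (a k)%:C * s ^+ k) @ \oo --> f s /\
      series (fun k => (b k)%:C * s ^+ k) @ \oo --> f s by exact: filterI fa fb.
  move=> /nbhs_norm0P[e /= e0 h].
  exists (complex.Re e / 2).
    by rewrite divr_gt0// -ltcR RRe_real// gtr0_real.
  move=> s se; apply: h => /=; apply: le_lt_trans se _.
  rewrite -[ltRHS](RRe_real (gtr0_real e0)) ltcR ltr_pdivrMr// ltr_pMr ?ltr1n//.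
  by rewrite -ltcR RRe_real// gtr0_real.
apply/funext => k; apply/eqP; rewrite -subr_eq0; apply/eqP.
apply: (@power_series_eq0 (fun k => a k - b k) e e0 _ k) => t t0 te.
have te' : `|t%:C : R[i]| <= e%:C by rewrite ger0_norm ?lecR// ltW.
have [/cvg_Re ca /cvg_Re cb] := fe _ te'.
have -> : series (fun k => (a k - b k) * t ^+ k) = (fun n =>
    complex.Re (series (fun k => (a k)%:C * t%:C ^+ k) n) -
    complex.Re (series (fun k => (b k)%:C * t%:C ^+ k) n)).
  apply/funext => n; rewrite !seriesEnat/= -raddfB -sumrB.
  under [in RHS]eq_bigr do rewrite -rmorphXn -!rmorphM -rmorphB -mulrBl.
  by rewrite -rmorph_sum.
rewrite -[X in _ --> X](subrr (complex.Re (f t%:C))).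
exact: cvgB ca cb.
Qed.

End PowerSeriesUniqueness.

(** * Coefficients of (1 - p)^-m *)

Section RenewalEquation.
Context {K : comNzRingType}.
Implicit Types (p : {poly K}) (X Y : nat -> K) (x : K).

(** Coefficientwise form of [Y = X + p * Y], that is, of [Y = X / (1 - p)]. *)
Definition renewal_eq p X Y :=
  forall k, Y k = X k + \sum_(i < k.+1) p`_i * Y (k - i)%N.

(** Truncation of [Y = X + p * Y]: the monomial of degree [i] in [p] shifts [Y] by [i], so only
    [N - i] terms of [Y] survive; for [i > N] the truncated subtraction leaves an empty sum. *)
Lemma renewal_partial_sum p X Y x N : renewal_eq p X Y ->
  \sum_(k < N) Y k * x ^+ k = \sum_(k < N) X k * x ^+ k +
    \sum_(i < size p) p`_i * x ^+ i * \sum_(k < N - i) Y k * x ^+ k.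
Proof.
move=> YE; elim: N => [|N IH].
  rewrite !big_ord0 add0r big1// => i _.
  by rewrite mulr0.
rewrite !big_ord_recr/= IH -!addrA; congr (_ + _).
rewrite YE mulrDl addrCA; congr (_ + _).
pose a i := p`_i * x ^+ i * (Y (N - i)%N * x ^+ (N - i)).
have -> : (\sum_(i < N.+1) p`_i * Y (N - i)%N) * x ^+ N = \sum_(i < N.+1) a i.
  rewrite mulr_suml; apply: eq_bigr => -[i /=]; rewrite ltnS => iN _.
  by rewrite /a -mulrA -mulrA; congr (_ * _); rewrite mulrCA -exprD subnKC.
have -> : \sum_(i < N.+1) a i = \sum_(i < size p | (i < N.+1)%N) a i.
  rewrite (big_ord_widen _ a (leq_addl (size p) N.+1)).
  rewrite (big_ord_widen_cond _ (fun i => (i < N.+1)%N) a (leq_addr N.+1 (size p))).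
  rewrite [LHS](bigID (fun i : 'I__ => (i < size p)%N))/= [X in _ + X]big1 ?addr0//.
  move=> i /andP[_]; rewrite -leqNgt => /leq_sizeP/(_ _ (leqnn _)) pi0.
  by rewrite /a pi0 !mul0r.
rewrite [X in _ + X]big_mkcond -big_split/=; apply: eq_bigr => i _.
rewrite /a; case: ltnP => [iN|iN].
  by rewrite subSn//= big_ord_recr/= mulrDr.
have [-> ->] : (N - i = 0 /\ N.+1 - i = 0)%N.
  by split; apply/eqP; rewrite subn_eq0// ltnW.
by rewrite addr0.
Qed.

(** Course-of-values recursion, meaningful for [k < n] only. The summand [i = 0] reads a value not
    yet computed, which is harmless when [p] has constant term 0. *)
Fixpoint renewal_upto p X n : nat -> K :=
  if n is m.+1 then
    fun k => if (k < m)%N then renewal_upto p X m k else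
      X m + \sum_(i < m.+1) p`_i * renewal_upto p X m (m - i)%N
  else fun=> 0.

Definition renewal p X k := renewal_upto p X k.+1 k.

Lemma renewalE p X : p`_0 = 0 -> renewal_eq p X (renewal p X).
Proof.
move=> p0 k; have uptoE n j : (j < n)%N -> renewal_upto p X n j = renewal p X j.
  elim: n => // n IH; rewrite ltnS leq_eqVlt => /predU1P[->//|jn] /=.
  by rewrite jn IH.
rewrite {1}/renewal/= ltnn; congr (_ + _); apply: eq_bigr => -[[|i] /= ik] _.
  by rewrite p0 !mul0r.
by rewrite uptoE// ltn_subrL; case: k ik.
Qed.

(* The coefficients of the power series (1 - p)^-m. *)
Definition inv_pow_coef p m := iter m (renewal p) (fun k => (k == 0%N)%:R).

Arguments inv_pow_coef : simpl never.

Lemma inv_pow_coefS p m : p`_0 = 0 ->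
  renewal_eq p (inv_pow_coef p m) (inv_pow_coef p m.+1).
Proof. exact: renewalE. Qed.

Lemma renewal_eqE p X Y : p`_0 = 0 -> renewal_eq p X Y ->
  forall k, Y k = X k + \sum_(i < k) p`_i.+1 * Y (k - i.+1)%N.
Proof. by move=> p0 YE k; rewrite {1}YE big_ord_recl p0 mul0r add0r. Qed.

End RenewalEquation.
Arguments inv_pow_coef : simpl never.

Section RenewalBounds.
Context {R : realType} (p : {poly R}).
Hypotheses (p_ge0 : forall i, 0 <= p`_i) (p0 : p`_0 = 0) (p1 : 0 < p`_1).
Variable (s0 : R).
Hypotheses (s0_gt0 : 0 < s0) (ps0 : p.[s0] = 1).
Local Notation g := (inv_pow_coef p).

Lemma inv_pow_coef_ge0 m k : 0 <= g m k.
Proof.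
elim: m k => [|m IH] k; first by rewrite ler0n.
elim/ltn_ind: k => k IHk; rewrite (renewal_eqE p0 (inv_pow_coefS m p0)).
rewrite addr_ge0 ?IH// sumr_ge0// => i _.
by rewrite mulr_ge0 ?p_ge0// IHk// ltn_subrL/=; case: k IHk i => [|k]//; move=> ? [].
Qed.

Lemma inv_pow_coef0 m : g m 0 = 1.
Proof.
elim: m => // m IH.
by rewrite (renewal_eqE p0 (inv_pow_coefS m p0)) big_ord0 addr0.
Qed.

Lemma inv_pow_coef_gt0 m k : 0 < g m.+1 k.
Proof.
elim: k => [|k IH]; first by rewrite inv_pow_coef0.
rewrite (renewal_eqE p0 (inv_pow_coefS m p0)) ltr_wpDl ?inv_pow_coef_ge0//.
rewrite big_ord_recl ltr_pwDl ?subSS ?subn0 ?mulr_gt0// sumr_ge0// => i _.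
by rewrite mulr_ge0// inv_pow_coef_ge0.
Qed.

Lemma poly_ltr_s0 (s : R) : 0 <= s -> s < s0 -> p.[s] < 1.
Proof.
move=> s_ge0 ss0; rewrite -ps0 !horner_coef.
have sp : (1 < size p)%N.
  by rewrite ltnNge; apply/negP => /leq_sizeP/(_ _ (leqnn 1)) h; move: p1; rewrite h ltxx.
rewrite (bigD1 (Ordinal sp))//= [ltRHS](bigD1 (Ordinal sp))//=.
apply: ltr_leD; first by rewrite !expr1 ltr_pM2l.
by apply: ler_sum => i _; rewrite ler_wpM2l// lerXn2r ?nnegrE// ltW.
Qed.

(** Induction on [m]: completing the inner sums of [renewal_partial_sum] to [N] terms adds
    nonnegative terms, so the new partial sum [S] is at most the previous one plus [p.[s] * S]; then
    divide by [1 - p.[s] > 0]. *)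
Lemma inv_pow_coef_sum_le m (s : R) N : 0 <= s -> s < s0 ->
  \sum_(k < N) g m k * s ^+ k <= (1 - p.[s]) ^- m.
Proof.
move=> s_ge0 ss0; have ps1 := poly_ltr_s0 s_ge0 ss0.
elim: m => [|m IH].
  rewrite expr0 invr1; case: N => [|N]; first by rewrite big_ord0.
  by rewrite big_ord_recl big1 ?addr0 ?mulr1// => i _; rewrite mul0r.
set S := (X in X <= _).
have SE : S = \sum_(k < N) g m k * s ^+ k +
    \sum_(i < size p) p`_i * s ^+ i * \sum_(k < N - i) g m.+1 k * s ^+ k.
  exact: renewal_partial_sum (inv_pow_coefS m p0).
rewrite exprS invfM mulrC ler_pdivlMr ?subr_gt0// mulrBr mulr1 lerBlDr.
rewrite {1}SE lerD// horner_coef mulr_sumr; apply: ler_sum => i _.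
rewrite mulrC ler_wpM2r//; first by rewrite mulr_ge0 ?exprn_ge0.
rewrite (big_ord_widen N (fun k => g m.+1 k * s ^+ k)) ?leq_subr//.
rewrite [leRHS](bigID (fun k : 'I_N => k < N - i)%N)/= lerDl sumr_ge0// => k _.
by rewrite mulr_ge0 ?exprn_ge0 ?inv_pow_coef_ge0.
Qed.

(* For m = 1, g k * s0 ^ k is an average, with weights p_i s0^i, of its preceding
   values, hence it is at least the minimum of its first size p values.  The
   renewal equation then propagates the bound to every m. *)
Lemma inv_pow_coef_shift m : exists2 c : R, 0 < c &
  forall k l, g m.+1 k <= c * s0 ^+ l * g m.+1 (k + l).
Proof.
pose u k := g 1 k * s0 ^+ k.
have u_gt0 k : 0 < u k by rewrite mulr_gt0 ?exprn_gt0 ?inv_pow_coef_gt0.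
have [b b_gt0 ub] : exists2 b : R, 0 < b & forall k, (k < size p)%N -> b <= u k.
  elim: (size p) => [|n [b b0 IH]]; first by exists 1.
  exists (Num.min b (u n)); first by rewrite lt_min b0 u_gt0.
  by move=> k; rewrite ltnS leq_eqVlt ge_min => /predU1P[->|/IH->//]; rewrite lexx orbT.
have {}ub k : b <= u k.
  elim/ltn_ind: k => k IH; have [/ub//|pk] := ltnP k (size p).
  have k0 : k != 0%N.
    by apply: contraTneq pk => ->; rewrite leqn0 size_poly_eq0;
      apply: contraTneq p1 => ->; rewrite coef0 ltxx.
  rewrite /u (inv_pow_coefS 0 p0) -[inv_pow_coef p 0 k]/((k == 0%N)%:R) (negbTE k0)
    add0r mulr_suml.
  rewrite -[leLHS]mul1r -ps0 horner_coef mulr_suml.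
  rewrite (big_ord_widen k.+1 (fun i => p`_i * s0 ^+ i * b)) ?(leq_trans pk)//.
  rewrite [leRHS](bigID (fun i : 'I__ => i < size p)%N)/= -[leLHS]addr0 lerD//;
    last first.
    apply: sumr_ge0 => i _; rewrite !mulr_ge0 ?exprn_ge0 ?(ltW s0_gt0)//.
    exact: (inv_pow_coef_ge0 1).
  apply: ler_sum => -[[|i] /= ik] _; first by rewrite p0 !mul0r.
  rewrite -mulrA -mulrA ler_wpM2l//.
  rewrite -[in s0 ^+ k](subnKC (ltnSE ik)) exprD mulrCA ler_wpM2l ?exprn_ge0 ?(ltW
    s0_gt0)//.
  by apply: IH; rewrite ltn_subrL/= lt0n.
exists b^-1; first by rewrite invr_gt0.
have c0 l : 0 <= b^-1 * s0 ^+ l by rewrite mulr_ge0 ?invr_ge0 ?exprn_ge0 ?ltW.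
(* Term by term comparison of two renewal equations; the one at [k + l] has further terms, all
   nonnegative. *)
have gS m' k l : g m' k <= b^-1 * s0 ^+ l * g m' (k + l) ->
    (forall j, (j < k)%N -> g m'.+1 j <= b^-1 * s0 ^+ l * g m'.+1 (j + l)) ->
  g m'.+1 k <= b^-1 * s0 ^+ l * g m'.+1 (k + l).
  move=> Xk Yk; rewrite !(renewal_eqE p0 (inv_pow_coefS m' p0)) mulrDr lerD//.
  rewrite (big_ord_widen (k + l) (fun i => p`_i.+1 * g m'.+1 (k - i.+1)%N)) ?leq_addr//.
  rewrite mulr_sumr [leRHS](bigID (fun i : 'I__ => i < k)%N)/= -[leLHS]addr0 lerD//.
    apply: ler_sum => -[i /= _] ik; rewrite mulrCA ler_wpM2l//.
    rewrite -addnBAC//; apply: Yk; rewrite ltn_subrL/= (leq_ltn_trans _ ik)//.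
  by apply: sumr_ge0 => i _; rewrite mulr_ge0// mulr_ge0// inv_pow_coef_ge0.
elim: m => [|m IH] k l.
  elim/ltn_ind: k => -[|k] IH; last first.
    by apply: gS => //; rewrite -[leLHS]/(0 : R) mulr_ge0// inv_pow_coef_ge0.
  (* At [k = 0] the source term 1 has no counterpart at [l > 0]; the lower bound [b <= u l] replaces
     the comparison. *)
  rewrite inv_pow_coef0 add0n -mulrA -(mulVf (lt0r_neq0 b_gt0)).
  by rewrite ler_wpM2l ?invr_ge0 ?(ltW b_gt0)// mulrC; exact: ub.
by elim/ltn_ind: k => k IHk; apply: gS => //; exact: IH.
Qed.

End RenewalBounds.

(** * Convergence of the series of (1 - p)^-m and the limit of the coefficient ratios *)

Section GeneratingSeries.
Context {R : realType} (p : {poly R}).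
Hypotheses (p_ge0 : forall i, 0 <= p`_i) (p0 : p`_0 = 0) (p1 : 0 < p`_1).
Variable (s0 : R).
Hypotheses (s0_gt0 : 0 < s0) (ps0 : p.[s0] = 1).
Local Notation g := (inv_pow_coef p).

(** For [s < t < s0] the numbers [g m k * t ^+ k] stay bounded, and the factor [(s / t) ^+ k]
    decays. *)
Lemma inv_pow_coef_cvg0 m (s : R) : 0 <= s -> s < s0 ->
  (fun k => g m k * s ^+ k) @ \oo --> (0 : R).
Proof.
move=> s_ge0 ss0.
have [t st ts0] : exists2 t, s < t & t < s0.
  by exists ((s + s0) / 2); rewrite midf_lt.
have t_gt0 : 0 < t by apply: le_lt_trans st.
pose B := (1 - p.[t]) ^- m.
have gB k : g m k * t ^+ k <= B.
  have := inv_pow_coef_sum_le p_ge0 p0 p1 s0_gt0 ps0 m k.+1 (ltW t_gt0) ts0.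
  rewrite big_ord_recr/=; apply: le_trans; rewrite lerDr sumr_ge0// => i _.
  by rewrite mulr_ge0 ?exprn_ge0 ?(ltW t_gt0)// inv_pow_coef_ge0.
have st1 : `|s / t| < 1.
  by rewrite ger0_norm ?ltr_pdivrMr ?mul1r// divr_ge0// ltW.
apply: squeeze_cvgr (cvg_cst _) (cvg_geometric B st1).
near=> k; rewrite mulr_ge0 ?exprn_ge0 ?inv_pow_coef_ge0//=.
rewrite -{1}(divfK (lt0r_neq0 t_gt0) s) exprMn mulrCA mulrC ler_wpM2r//.
by rewrite exprn_ge0// divr_ge0// ltW.
Unshelve. all: by end_near. Qed.

(** Induction on [m]. The partial sums satisfy [(1 - p(x)) T_N = S_N - sum_i p_i x^i (T_N -
    T_(N-i))], with [S_N] those of the preceding power; each difference has fewer than [size p]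
    terms, all tending to 0. *)
Lemma inv_pow_coef_series m (x : R[i]) : `|x| < s0%:C ->
  series (fun k => (g m k)%:C * x ^+ k) @ \oo -->
    (1 - (map_poly (real_complex R) p).[x]) ^- m.
Proof.
move=> xs0; set pC := map_poly _ p; pose gC m k := (g m k)%:C.
have [a a_ge0 xa] := normC_realE x; move: xs0; rewrite xa ltcR => as0.
have gC0 n : (fun k => gC n k * x ^+ k) @ \oo --> 0.
  apply: (cvg_norm_le _ (inv_pow_coef_cvg0 n a_ge0 as0)) => k.
  rewrite sub0r normrN normrM normrX xa ger0_norm ?ler0c ?inv_pow_coef_ge0//.
  by rewrite rmorphM rmorphXn.
have px1 : 1 - pC.[x] != 0.
  have pxle : `|pC.[x]| <= (p.[a])%:C.
    rewrite !horner_coef rmorph_sum/= size_map_poly;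
      apply: le_trans (ler_norm_sum _ _ _) _.
    apply: ler_sum => i _; rewrite coef_map normrM normrX rmorphM rmorphXn xa.
    by rewrite ger0_norm ?ler0c.
  rewrite subr_eq0 eq_sym; apply: contraTneq pxle => ->.
  by rewrite normr1 lecR -ltNge (poly_ltr_s0 p_ge0 p1 s0_gt0 ps0).
elim: m => [|m IH].
  rewrite expr0 invr1 -(cvg_shiftn 1); apply: cvg_near_cst; near=> n.
  rewrite seriesEnat/= addn1 big_nat_recl// big1 ?addr0 ?mulr1// => i _.
  by rewrite mul0r.
pose T N := \sum_(k < N) gC m.+1 k * x ^+ k; pose D := size pC.
have gCE : renewal_eq pC (gC m) (gC m.+1).
  move=> k; rewrite /gC inv_pow_coefS// rmorphD rmorph_sum/=; congr (_ + _).
  by apply: eq_bigr => i _; rewrite rmorphM coef_map.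
(* The shift by [D] ensures [i <= N + D], so the subtraction is never truncated. *)
have TE N : T (N + D)%N = (1 - pC.[x])^-1 * (series (fun k => gC m k * x ^+ k) (N + D)%N -
    \sum_(i < D) pC`_i * x ^+ i * (T (N + D)%N - T (N + D - i)%N)).
  apply: (mulfI px1); rewrite mulrA mulfV// mul1r.
  rewrite mulrBl mul1r {1}/T (renewal_partial_sum x (N + D) gCE) seriesEnat/= big_mkord.
  rewrite -addrA; congr (_ + _); under [in RHS]eq_bigr do rewrite mulrBr.
  by rewrite sumrB opprB horner_coef mulr_suml.
suff Tcvg : T @ \oo --> (1 - pC.[x]) ^- m.+1.
  apply: cvg_trans Tcvg; apply: near_eq_cvg; near=> n.
  by rewrite /T seriesEnat/= big_mkord.
rewrite exprS invfM -(cvg_shiftn D) [X in X @ _](funext TE : _ = _).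
apply: cvgMl_tmp; rewrite -[X in _ --> X]subr0; apply: cvgB.
  by rewrite (cvg_shiftn D).
apply: (@cvg_sum0 _ _ (fun i N => pC`_i * x ^+ i * (T (N + D)%N - T (N + D - i)%N))) =>
  i iD.
rewrite -[X in _ --> X](mulr0 (pC`_i * x ^+ i)); apply: cvgMl_tmp.
have -> : (fun N => T (N + D)%N - T (N + D - i)%N) =
    (fun N => \sum_(j < i) gC m.+1 (N + (D - i + j))%N * x ^+ (N + (D - i + j))).
  apply/funext => N; rewrite -{1}(@subnK i (N + D)) ?(leq_trans (ltnW iD))// ?leq_addl//.
  rewrite /T big_split_ord/= addrAC subrr add0r; apply: eq_bigr => j _.
  by rewrite addnA addnBA// ltnW.
apply: (@cvg_sum0 _ _ (fun j N => gC m.+1 (N + (D - i + j))%N * x ^+ (N + (D - i +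
  j)))) => j _.
have := gC0 m.+1; rewrite -(cvg_shiftn (D - i + j)); exact.
Unshelve. all: by end_near. Qed.

(** The shift bound gives the upper estimate [sqrt(c)^(1/l) sqrt(s0)]. For [l > 0] also [sqrt(s0)]
    is a lower estimate: a smaller supremum, iterated along the multiples of [l], would keep
    [g m.+1 k * (t ^+ 2) ^+ k] at least 1 there with [t ^+ 2 < s0], against [inv_pow_coef_cvg0]. *)
Lemma ratio_sup_inv_pow_coef m :
  ratio_sup (g m.+1) l @[l --> \oo] --> (Num.sqrt s0)%:E.
Proof.
have r0 : 0 < Num.sqrt s0 by rewrite sqrtr_gt0.
have [c c0 gc] := inv_pow_coef_shift p_ge0 p0 p1 s0_gt0 ps0 m.
have g0 k : 0 < g m.+1 k by exact: inv_pow_coef_gt0.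
pose q l k : R := Num.sqrt (g m.+1 k) / Num.sqrt (g m.+1 (k + l)%N).
have q_ge0 l k : 0 <= q l k by rewrite divr_ge0 ?sqrtr_ge0.
apply: (@squeeze_cvge _ _ _ _ (fun=> (Num.sqrt s0)%:E) _
   (fun l => (Num.sqrt c `^ l%:R^-1 * Num.sqrt s0)%:E)).
- near=> l; have l0 : (0 < l)%N by near: l; exists 1%N.
  have l0' : (l%:R : R) != 0 by rewrite pnatr_eq0 -lt0n.
  apply/andP; split; last first.
    apply: ge_ereal_sup => _ [k _ <-]; rewrite lee_fin.
    have -> : Num.sqrt s0 = (Num.sqrt s0 ^+ l) `^ l%:R^-1.
      by rewrite -powR_mulrn ?sqrtr_ge0// -powRrM mulfV// powRr1// sqrtr_ge0.
    rewrite -powRM ?exprn_ge0 ?sqrtr_ge0// ge0_ler_powR ?nnegrE ?q_ge0 ?mulr_ge0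
      ?exprn_ge0 ?sqrtr_ge0//.
    rewrite ler_pdivrMr ?sqrtr_gt0//.
    rewrite -[X in _ * X * _](ger0_norm (exprn_ge0 l (sqrtr_ge0 s0))) -sqrtr_sqr -exprM
      mulnC exprM.
    rewrite sqr_sqrtr ?(ltW s0_gt0)// -!sqrtrM ?ler_sqrt ?mulr_ge0 ?exprn_ge0 ?(ltW c0)
      ?(ltW s0_gt0) ?(ltW (g0 _))//.
  rewrite leNgt; apply/negP => sup_lt.
  have [t [t0 tr qt]] : exists t : R, [/\ 0 < t, t < Num.sqrt s0 &
      forall k, g m.+1 k <= t ^+ 2 ^+ l * g m.+1 (k + l)%N].
    have qsup k : ((q l k `^ l%:R^-1)%:E <= ratio_sup (g m.+1) l)%E.
      by apply: ereal_sup_ubound; exists k.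
    have q0 k : 0 < q l k by rewrite divr_gt0 ?sqrtr_gt0.
    case E : (ratio_sup (g m.+1) l) sup_lt qsup => [t| |] //; last first.
      by move=> _ /(_ 0%N); rewrite leeNy_eq.
    rewrite lte_fin => tr qt; exists t; split => //.
      by have := qt 0%N; rewrite lee_fin; apply: lt_le_trans; rewrite powR_gt0.
    move=> k; have := qt k; rewrite lee_fin => qtk.
    have t0 : 0 <= t by apply: le_trans qtk; rewrite powR_ge0.
    have qk : q l k <= t ^+ l.
      have -> : q l k = (q l k `^ l%:R^-1) `^ l%:R by rewrite -powRrM mulVf// powRr1.
      by rewrite -powR_mulrn// ge0_ler_powR ?nnegrE ?powR_ge0.
    move: qk; rewrite ler_pdivrMr ?sqrtr_gt0// => qk.
    rewrite -ler_sqrt ?mulr_ge0 ?exprn_ge0 ?(ltW (g0 _))//.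
    rewrite sqrtrM ?exprn_ge0// -exprM mulnC exprM sqrtr_sqr ger0_norm ?exprn_ge0//.
  have gl k : 1 <= g m.+1 (k * l)%N * (t ^+ 2) ^+ (k * l).
    elim: k => [|k IH]; first by rewrite mul0n inv_pow_coef0// mulr1.
    apply: le_trans IH _; rewrite mulSn addnC exprD mulrA.
    rewrite mulrAC ler_wpM2r ?exprn_ge0 ?(ltW t0)// mulrC; exact: qt.
  have t2 : t ^+ 2 < s0 by rewrite -[ltRHS]sqr_sqrtr ?(ltW s0_gt0)// ltrXn2r ?nnegrE
    ?(ltW t0).
  have /cvgrPdist_lt/(_ 1 ltr01)[N _ hN] := inv_pow_coef_cvg0 m.+1 (exprn_ge0 2 (ltW
    t0)) t2.
  have /hN/= : (N <= N * l)%N by rewrite leq_pmulr.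
  by rewrite sub0r normrN ltNge => /negP; apply; apply: le_trans (gl N) (ler_norm _).
- exact: cvg_cst.
- apply: cvg_EFin; first by near=> l.
  rewrite -[X in _ --> X]mul1r; apply: cvgMr_tmp.
  have -> : (fun l : nat => Num.sqrt c `^ l%:R^-1) = (fun l => expR (l%:R^-1 * ln
    (Num.sqrt c))).
    by apply/funext => l; rewrite /powR gt_eqF ?sqrtr_gt0.
  rewrite -[X in _ --> X](@expR0 R); apply: continuous_cvg; first exact: continuous_expR.
  rewrite -[X in _ --> X](mul0r (ln (Num.sqrt c))); apply: cvgMr_tmp.
  rewrite -cvg_shiftS; exact: cvg_harmonic.
Unshelve. all: by end_near. Qed.
End GeneratingSeries.

(** * Interpolation and multipliers in a reproducing kernel space *)

Lemma cauchy_cvg_norm (R : realType) (V : completeNormedModType R[i])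
    (u : nat -> V) (e : nat -> R) :
  (forall i j, (i <= j)%N -> `|u i - u j| <= (e i)%:C) -> e @ \oo --> 0 ->
  cvg (u @ \oo).
Proof.
move=> ue e0; apply/cauchy_cvgP/cauchy_exP => eps eps0.
have [r er] : exists r, eps = r%:C by exists (complex.Re eps);
  rewrite RRe_real// gtr0_real.
move: eps0; rewrite er ltcR => r0.
have /cvgrPdist_lt/(_ r r0)[N _ eN] := e0.
exists (u N); exists N => // j /= Nj; rewrite -ball_normE/=.
apply: le_lt_trans (ue _ _ Nj) _; rewrite ltcR.
apply: le_lt_trans (ler_norm _) _; rewrite -normrN -sub0r; apply: eN => //=.
Qed.

Lemma addC_conj (R : rcfType) (z : R[i]) : z + Num.conj z = (2 * complex.Re z)%:C.
Proof. by rewrite rmorphM rmorph_nat; exact: addcJ. Qed.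

Section DotNorm.
Context {R : realType} {V : completeNormedModType R[i]} (dot : {dot V for Num.conj}).
Hypothesis dot_norm : forall f, dot f f = `|f| ^+ 2.

Definition rnorm (f : V) : R := complex.Re `|f|.

Lemma rnormE f : `|f| = (rnorm f)%:C. Proof. exact: normC_Re. Qed.

Lemma rnorm_ge0 f : 0 <= rnorm f. Proof. exact: Re_norm_ge0. Qed.

Lemma dot_rnorm f : dot f f = (rnorm f ^+ 2)%:C.
Proof. by rewrite dot_norm rnormE rmorphXn. Qed.

Lemma rnormZ_sq a f : rnorm (a *: f) ^+ 2 = complex.Re (a * Num.conj a) * rnorm f ^+ 2.
Proof.
apply: complexI; rewrite -dot_rnorm linearZl_LR linearZr_LR/= dot_rnorm mulrA.
by rewrite [RHS]rmorphM/= RRe_real// -normCK realX// normr_real.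
Qed.

Lemma rnormD_sq f g :
  rnorm (f + g) ^+ 2 = rnorm f ^+ 2 + rnorm g ^+ 2 + 2 * complex.Re (dot f g).
Proof.
by apply: complexI; rewrite -dot_rnorm dnormD addC_conj !dot_rnorm -!rmorphD.
Qed.

Lemma rnormB_sq f g :
  rnorm (f - g) ^+ 2 = 2 * rnorm f ^+ 2 + 2 * rnorm g ^+ 2 - rnorm (f + g) ^+ 2.
Proof.
have -> : rnorm (f - g) ^+ 2 = rnorm f ^+ 2 + rnorm g ^+ 2 - 2 * complex.Re (dot f g).
  by apply: complexI; rewrite -dot_rnorm dnormB addC_conj !dot_rnorm -rmorphD -rmorphB.
by rewrite rnormD_sq; ring.
Qed.

Lemma dot_Cauchy_Schwarz f g : `|dot f g| <= (rnorm f * rnorm g)%:C.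
Proof.
have [->|g0] := eqVneq g 0.
  by rewrite linear0r normr0 ler0c mulr_ge0 ?rnorm_ge0.
have gg0 : 0 < dot g g by rewrite dnorm_gt0.
(* [t *: g] is the orthogonal projection of [f] on [g]; the squared norm of [f - t *: g] is
   nonnegative. *)
pose d := dot f g; pose t := d / dot g g.
have := dnorm_ge0 dot (f - t *: g).
rewrite dnormB dnormZ linearZr_LR/= -/d.
have ggR : Num.conj (dot g g) = dot g g by rewrite dot_rnorm; exact: conjc_real.
have -> : Num.conj t * d = `|d| ^+ 2 / dot g g.
  by rewrite /t rmorphM fmorphV/= ggR mulrAC [Num.conj d * d]mulrC -normCK.
have -> : Num.conj (`|d| ^+ 2 / dot g g) = `|d| ^+ 2 / dot g g.
  by rewrite rmorphM fmorphV/= ggR rmorphXn/= conj_Creal ?normr_real.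
have -> : `|t| ^+ 2 * dot g g = `|d| ^+ 2 / dot g g.
  rewrite /t normrM normfV (ger0_norm (ltW gg0)) exprMn exprVn -mulrA; congr (_ * _).
  by rewrite expr2 invfM -mulrA mulVf ?mulr1// gt_eqF.
rewrite opprD addrA addrK subr_ge0 ler_pdivrMr// !dot_rnorm -rmorphM => h.
rewrite -(@ler_pXn2r _ 2) ?nnegrE ?normr_ge0 ?ler0c ?mulr_ge0 ?rnorm_ge0//.
by have -> : (rnorm f * rnorm g)%:C ^+ 2 = (rnorm f ^+ 2 * rnorm g ^+ 2)%:C
  by rewrite -exprMn rmorphXn.
Qed.

End DotNorm.

Section Interpolation.
Context {R : realType} {n : nat} {Omega : set 'rV[R[i]]_n}
  {K : 'rV[R[i]]_n -> 'rV[R[i]]_n -> R[i]} (H : rkhs Omega K).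
Implicit Types (v : seq (R[i] * 'rV[R[i]]_n)) (f g h : H).

Definition kernel_comb v : H := \sum_(x <- v) x.1 *: kernel_at H x.2.

(** The value forced on the inner product of [h] with [kernel_comb v] when [h] takes the values [G]
    at the nodes. *)
Definition dual_sum (G : 'rV[R[i]]_n -> R[i]) v : R[i] :=
  \sum_(x <- v) Num.conj x.1 * G x.2.

Definition nodes_in v := forall x, x \in v -> Omega x.2.

Lemma fun_of_linear a f g w : Omega w ->
  fun_of (a *: f + g) w = a * fun_of f w + fun_of g w.
Proof. by move=> Ow; rewrite -!reproducing// linearDl linearZl_LR. Qed.

Lemma fun_ofZ a f w : Omega w -> fun_of (a *: f) w = a * fun_of f w.
Proof. by move=> Ow; rewrite -!reproducing// linearZl_LR. Qed.

Lemma fun_ofB f g w : Omega w -> fun_of (f - g) w = fun_of f w - fun_of g w.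
Proof. by move=> Ow; rewrite addrC -scaleN1r fun_of_linear// mulN1r addrC. Qed.

Lemma fun_of_sum (I : Type) (r : seq I) (P : pred I) (F : I -> H) w : Omega w ->
  fun_of (\sum_(i <- r | P i) F i) w = \sum_(i <- r | P i) fun_of (F i) w.
Proof.
move=> Ow; rewrite -reproducing// linear_sumlz.
by apply: eq_bigr => i _; exact: reproducing.
Qed.

Lemma inner_comb f v : nodes_in v -> inner H f (kernel_comb v) = dual_sum (fun_of f) v.
Proof.
move=> Ov; rewrite linear_sumr big_seq [RHS]big_seq; apply: eq_bigr => x xv.
by rewrite linearZr_LR/= reproducing//; exact: Ov.
Qed.

Lemma fun_of_le f w : Omega w -> `|fun_of f w| <= (rnorm f * rnorm (kernel_at H w))%:C.
Proof.
by move=> Ow; rewrite -reproducing//; apply: dot_Cauchy_Schwarz => ?; exact: inner_norm.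
Qed.

Lemma cvg_fun_of (u : nat -> H) h w : Omega w -> u @ \oo --> h ->
  (fun k => fun_of (u k) w) @ \oo --> fun_of h w.
Proof.
move=> Ow /cvg_Re_norm uh.
apply: (@cvg_norm_le _ _ _ _ (fun k => rnorm (h - u k) * rnorm (kernel_at H w))).
  by move=> k; have := fun_of_le (h - u k) Ow; rewrite fun_ofB.
by rewrite -[X in _ --> X](mul0r (rnorm (kernel_at H w))); apply: cvgMr_tmp.
Qed.

Let J G v : R := 2 * complex.Re (dual_sum G v) - rnorm (kernel_comb v) ^+ 2.

Lemma kernel_comb_cat v1 v2 : kernel_comb (v1 ++ v2) = kernel_comb v1 + kernel_comb v2.
Proof. exact: big_cat. Qed.

Lemma dual_sum_cat G v1 v2 : dual_sum G (v1 ++ v2) = dual_sum G v1 + dual_sum G v2.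
Proof. exact: big_cat. Qed.

Let half_sum v1 v2 := [seq (2^-1 * x.1, x.2) | x <- v1 ++ v2].

(** Parallelogram identity for the concave functional [J]; the last term makes maximising sequences
    Cauchy. *)
Let J_half_sum G v1 v2 :
  J G (half_sum v1 v2) = (J G v1 + J G v2) / 2 +
    rnorm (kernel_comb v1 - kernel_comb v2) ^+ 2 / 4.
Proof.
have combE : kernel_comb (half_sum v1 v2) = 2^-1 *: (kernel_comb v1 + kernel_comb v2).
  rewrite /kernel_comb big_map -kernel_comb_cat /kernel_comb scaler_sumr.
  by apply: eq_bigr => x _; rewrite scalerA.
have half_conj : Num.conj (2^-1 : R[i]) = 2^-1 by rewrite fmorphV rmorph_nat.
have dualE : dual_sum G (half_sum v1 v2) = 2^-1 * (dual_sum G v1 + dual_sum G v2).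
  rewrite /dual_sum big_map -dual_sum_cat /dual_sum mulr_sumr.
  by apply: eq_bigr => x _; rewrite rmorphM/= half_conj mulrA.
have ReH (z : R[i]) : complex.Re (2^-1 * z) = complex.Re z / 2.
  have -> : (2^-1 : R[i]) = (2^-1 : R)%:C by rewrite fmorphV rmorph_nat.
  by case: z => a b /=; rewrite mul0r subr0 mulrC.
rewrite /J combE dualE ReH (rnormZ_sq (@inner_norm _ _ _ _ H)) half_conj ReH.
have -> : complex.Re (2^-1 : R[i]) = 2^-1 by rewrite -[2^-1]mulr1 ReH/= mul1r.
rewrite raddfD/= (rnormB_sq (@inner_norm _ _ _ _ H)); lra.
Qed.

(* The element h is found by maximising the functional
   v |-> 2 Re <h, comb v> - |comb v|^2, where <h, comb v> is prescribed. *)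
Lemma interpolation (G : 'rV[R[i]]_n -> R[i]) (M : R) :
  (forall v, nodes_in v -> `|dual_sum G v| <= (M * rnorm (kernel_comb v))%:C) ->
  exists h : H, forall w, Omega w -> fun_of h w = G w.
Proof.
move=> GM; have inner_normH := @inner_norm _ _ _ _ H.
pose E := [set J G v | v in nodes_in].
have E_ub : has_ubound E.
  (* From [2 M x - x^2 <= M^2], with [x] the norm of the combination. *)
  exists (M ^+ 2) => _ [v Ov <-]; have := GM v Ov.
  move=> /(le_trans (normc_ge_Re _)); rewrite lecR => h.
  have {}h := le_trans (ler_norm _) h.
  rewrite /J; apply: (@le_trans _ _ (2 * (M * rnorm (kernel_comb v)) - rnorm
    (kernel_comb v) ^+ 2)).
    by rewrite lerD2r ler_pM2l.
  rewrite -subr_ge0 (_ : _ - _ = (M - rnorm (kernel_comb v)) ^+ 2) ?sqr_ge0//; ring.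
have E_sup : has_sup E by split=> //; exists (J G [::]); exists [::].
have Jsup v : nodes_in v -> J G v <= sup E.
  by move=> Ov; apply: ub_le_sup => //; exists v.
have eps_gt0 k : 0 < (k.+1%:R^-1 : R) by rewrite invr_gt0 ltr0n.
have /choice[u uP] : forall k, exists v, nodes_in v /\ sup E - k.+1%:R^-1 < J G v.
  by move=> k; have [_ [v Ov <-] Jv] := sup_adherent (eps_gt0 k) E_sup; exists v.
pose c k := kernel_comb (u k).
have [h ch] : exists h : H, c @ \oo --> h.
  (* For [i <= j] both values of [J] exceed [sup E - 1/(i+1)], while the midpoint stays below
     [sup E]; so the squared distance is at most [4/(i+1)]. *)
  suff /cvg_ex[h ch] : cvg (c @ \oo) by exists h.
  apply: (@cauchy_cvg_norm _ _ _ (fun k => Num.sqrt (4 * k.+1%:R^-1))) => [i j ij|].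
    rewrite rnormE lecR -(ger0_norm (rnorm_ge0 _)) -sqrtr_sqr ler_sqrt; last first.
      by rewrite mulr_ge0// ltW.
    have Oij : nodes_in (half_sum (u i) (u j)).
      move=> _ /mapP[x + ->] /=; rewrite mem_cat.
      by case/orP; [apply: (uP i).1|apply: (uP j).1].
    have := Jsup _ Oij; rewrite J_half_sum -/(c i) -/(c j).
    have := (uP i).2; have := (uP j).2.
    have : (j.+1%:R^-1 : R) <= i.+1%:R^-1 by rewrite lef_pV2 ?posrE ?ltr0n// ler_nat.
    move: (J G (u i)) (J G (u j)) (rnorm _ ^+ 2) (sup E) (i.+1%:R^-1) (j.+1%:R^-1).
    by move=> *; lra.
  rewrite -[X in _ --> X]sqrtr0 -[X in Num.sqrt X](mulr0 4).
  apply: continuous_cvg; first exact: sqrt_continuous.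
  by apply: cvgMl_tmp; exact: cvg_harmonic.
exists h => w Ow; apply/eqP; rewrite eq_sym -subr_eq0; apply/eqP.
set d : R[i] := G w - fun_of h w; set kap := rnorm (kernel_at H w) ^+ 2.
have kap_ge0 : 0 <= kap by rewrite sqr_ge0.
(* First variation: appending the node [(t, w)] to [u k] cannot push [J] above the supremum; then
   [k] tends to infinity. *)
have Jt (t : R[i]) : 2 * complex.Re (Num.conj t * d) <= complex.Re (t * Num.conj t) * kap.
  have step k : 2 * complex.Re (Num.conj t * (G w - fun_of (c k) w)) -
      k.+1%:R^-1 <= complex.Re (t * Num.conj t) * kap.
    have Ok : nodes_in (u k ++ [:: (t, w)]).
      by move=> x; rewrite mem_cat inE => /orP[/(uP k).1//|/eqP ->].
    have := Jsup _ Ok; have := (uP k).2; rewrite /J kernel_comb_cat dual_sum_cat.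
    rewrite (rnormD_sq inner_normH) -/(c k).
    have -> : kernel_comb [:: (t, w)] = t *: kernel_at H w by exact: big_seq1.
    have -> : dual_sum G [:: (t, w)] = Num.conj t * G w by exact: big_seq1.
    rewrite linearZr_LR/= reproducing//.
    rewrite (rnormZ_sq inner_normH) -/kap raddfD mulrBr raddfB/=.
    move: (complex.Re (dual_sum _ _)) (complex.Re (Num.conj t * G w)) (sup E)
      (complex.Re (Num.conj t * fun_of _ _)) (_ * kap) (rnorm (c k) ^+ 2) (k.+1%:R^-1).
    by move=> *; lra.
  have lhs : (fun k => 2 * complex.Re (Num.conj t * (G w - fun_of (c k) w)) -
      k.+1%:R^-1) @ \oo --> 2 * complex.Re (Num.conj t * d).
    rewrite -[X in _ --> X]subr0; apply: cvgB; last exact: cvg_harmonic.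
    apply: cvgMl_tmp; apply: cvg_Re; apply: cvgMl_tmp.
    by apply: cvgB; [exact: cvg_cst|exact: cvg_fun_of].
  rewrite -(cvg_lim (@Rhausdorff R) lhs).
  by apply: limr_le; [exact: cvgP lhs|near=> k].
have [a a_ge0 da] := normC_realE d.
have ddE : d * Num.conj d = (a ^+ 2)%:C by rewrite -normCK da rmorphXn.
(* At [t = tau * d] this choice makes the quadratic side at most [tau |d|^2], against [2 tau |d|^2]
   on the linear side; so [d = 0]. *)
pose tau := (kap + 1)^-1.
have tau_gt0 : 0 < tau by rewrite invr_gt0 ltr_wpDl.
have := Jt (tau%:C * d).
have -> : Num.conj (tau%:C * d) = tau%:C * Num.conj d.
  by rewrite rmorphM/=; congr (_ * _); exact: conjc_real.
have -> : tau%:C * Num.conj d * d = (tau * a ^+ 2)%:C.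
  by rewrite -mulrA [Num.conj d * d]mulrC ddE -rmorphM.
have -> : tau%:C * d * (tau%:C * Num.conj d) = (tau * tau * a ^+ 2)%:C.
  by rewrite mulrACA ddE -!rmorphM.
move=> /= tau_le.
have tkap : tau * kap <= 1 by rewrite mulrC ler_pdivrMr ?ltr_wpDl// mul1r lerDl.
have : tau * a ^+ 2 <= 0.
  have : tau * (tau * kap) * a ^+ 2 <= tau * a ^+ 2.
    by rewrite ler_wpM2r ?sqr_ge0// ger_pMr.
  by nra.
rewrite pmulr_rle0// => a2; apply/eqP; rewrite -normr_eq0 da.
have -> : a = 0 by apply/eqP; rewrite -sqrf_eq0 eq_le a2 sqr_ge0.
by [].
Unshelve. all: by end_near. Qed.

End Interpolation.
Arguments nodes_in {R n} Omega v.
Arguments dual_sum {R n} G v.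

(** * Positive kernels as pointwise limits of Gram kernels *)

Section PositiveKernels.
Context {R : realType} {n : nat} (Omega : set 'rV[R[i]]_n).
Local Notation T := 'rV[R[i]]_n.
Implicit Types (L : T -> T -> R[i]) (g : T -> R[i]).

Definition positive_kernel L := forall v : seq (R[i] * T), nodes_in Omega v ->
  0 <= \sum_(x <- v) \sum_(y <- v) x.1 * Num.conj y.1 * L y.2 x.2.

(** A concrete form of positivity. It passes to products by multiplying the functions pairwise,
    which stands in for the Schur product theorem. *)
Definition gram_limit L := exists s : nat -> seq (T -> R[i]),
  forall z w, Omega z -> Omega w ->
    (fun N => \sum_(a <- s N) a z * Num.conj (a w)) @ \oo --> L z w.

Lemma gram_limit_positive L : gram_limit L -> positive_kernel L.
Proof.
move=> [s sL] v Ov.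
pose S N := \sum_(x <- v) \sum_(y <- v) x.1 * Num.conj y.1 *
  \sum_(a <- s N) a y.2 * Num.conj (a x.2).
set l := (X in 0 <= X).
have Sl : S @ \oo --> l.
  rewrite /l (_ : S = fun N => \sum_(x <- v | x \in v) \sum_(y <- v | y \in v)
      x.1 * Num.conj y.1 * \sum_(a <- s N) a y.2 * Num.conj (a x.2)); last first.
    apply/funext => N; rewrite /S big_seq; apply: eq_bigr => x _.
    by rewrite big_seq.
  rewrite big_seq; under [X in _ --> X]eq_bigr do rewrite big_seq.
  apply: cvg_big => [|x xv]; first exact: add_continuous.
  apply: cvg_big => [|y yv]; first exact: add_continuous.
  by apply: cvgMl_tmp; apply: sL; exact: Ov.
have S_ge0 N : 0 <= S N.
  rewrite (_ : S N = \sum_(a <- s N) `|\sum_(x <- v) x.1 * Num.conj (a x.2)| ^+ 2).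
    by apply: sumr_ge0 => a _; rewrite exprn_ge0.
  rewrite /S; under eq_bigr do under eq_bigr do rewrite mulr_sumr.
  under eq_bigr do rewrite exchange_big/=.
  rewrite exchange_big/=; apply: eq_bigr => a _.
  rewrite normCK rmorph_sum/= mulr_suml; apply: eq_bigr => x _.
  rewrite mulr_sumr; apply: eq_bigr => y _.
  by rewrite rmorphM/= conjCK; ring.
(* [S] converges to [l] and, being nonnegative, also to [|l|]; hence [l = |l|]. *)
have Sn : S @ \oo --> `|l|.
  rewrite (_ : S = fun N => `|S N|); first exact: cvg_norm Sl.
  by apply/funext => N; rewrite ger0_norm.
by rewrite (cvg_unique (@norm_hausdorff _ _) Sl Sn).
Qed.

Lemma gram_limit_ext L1 L2 : (forall z w, Omega z -> Omega w -> L1 z w = L2 z w) ->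
  gram_limit L1 -> gram_limit L2.
Proof. by move=> L12 [s sL]; exists s => z w Oz Ow; rewrite -L12//; exact: sL. Qed.

Lemma gram_limit_rank1 g : gram_limit (fun z w => g z * Num.conj (g w)).
Proof.
exists (fun=> [:: g]) => z w _ _; rewrite big_seq1; exact: cvg_cst.
Qed.

Lemma gram_limitM L1 L2 : gram_limit L1 -> gram_limit L2 ->
  gram_limit (fun z w => L1 z w * L2 z w).
Proof.
move=> [s1 sL1] [s2 sL2].
exists (fun N => [seq (fun z => a z * b z) | a <- s1 N, b <- s2 N]) => z w Oz Ow.
apply: cvg_trans (cvgM (sL1 z w Oz Ow) (sL2 z w Oz Ow)).
apply: near_eq_cvg; near=> N.
rewrite /= big_allpairs_dep mulr_suml; apply: eq_bigr => a _.
rewrite mulr_sumr; apply: eq_bigr => b _.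
by rewrite rmorphM/=; ring.
Unshelve. all: by end_near. Qed.

Lemma gram_limit_prod (I : Type) (r : seq I) (P : pred I) (F : I -> T -> T -> R[i]) :
  (forall i, P i -> gram_limit (F i)) ->
  gram_limit (fun z w => \prod_(i <- r | P i) F i z w).
Proof.
move=> PF; elim: r => [|i r IH].
  apply: gram_limit_ext (gram_limit_rank1 (fun=> 1)) => z w _ _.
  by rewrite big_nil conjC1 mulr1.
case: (boolP (P i)) => Pi.
  by apply: gram_limit_ext (gram_limitM (PF i Pi) IH) => z w _ _; rewrite big_cons Pi.
by apply: gram_limit_ext IH => z w _ _; rewrite big_cons (negbTE Pi).
Qed.

Lemma gram_limit_series L g (d : nat -> R) : (forall k, 0 <= d k) ->
  (forall z w, Omega z -> Omega w ->
    series (fun k => (d k)%:C * (g z * Num.conj (g w)) ^+ k) @ \oo --> L z w) ->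
  gram_limit L.
Proof.
move=> d_ge0 dL.
exists (fun N => [seq (fun z => (Num.sqrt (d k))%:C * g z ^+ k) | k <- index_iota 0 N]).
move=> z w Oz Ow; apply: cvg_trans (dL z w Oz Ow).
apply: near_eq_cvg; near=> N; rewrite seriesEnat/= big_map; apply: eq_bigr => k _.
rewrite rmorphM rmorphXn/= exprMn.
have -> : Num.conj ((Num.sqrt (d k))%:C) = (Num.sqrt (d k))%:C by exact: conjc_real.
have -> : (d k)%:C = (Num.sqrt (d k))%:C * (Num.sqrt (d k))%:C.
  by rewrite -rmorphM -expr2 sqr_sqrtr.
ring.
Unshelve. all: by end_near. Qed.

End PositiveKernels.

(** * Multipliers obtained from positivity, and their resolvents *)

Section Multipliers.
Context {R : realType} {n : nat} {Omega : set 'rV[R[i]]_n}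
  {K : 'rV[R[i]]_n -> 'rV[R[i]]_n -> R[i]} (H : rkhs Omega K).
Local Notation T := 'rV[R[i]]_n.
Implicit Types (v : seq (R[i] * T)) (f h : H) (g : T -> R[i]).

Definition multiplier g := forall f, exists h : H,
  forall w, Omega w -> fun_of h w = g w * fun_of f w.

Lemma multiplierM g1 g2 : multiplier g1 -> multiplier g2 ->
  multiplier (fun w => g1 w * g2 w).
Proof.
move=> m1 m2 f; have [h2 h2E] := m2 f; have [h1 h1E] := m1 h2.
by exists h1 => w Ow; rewrite h1E// h2E// mulrA.
Qed.

Lemma multiplierZ a g : multiplier g -> multiplier (fun w => a * g w).
Proof.
move=> m f; have [h hE] := m f; exists (a *: h) => w Ow.
by rewrite fun_ofZ// hE// mulrA.
Qed.

Lemma multiplier_ext g1 g2 : (forall w, Omega w -> g1 w = g2 w) ->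
  multiplier g1 -> multiplier g2.
Proof.
by move=> g12 m f; have [h hE] := m f; exists h => w Ow; rewrite hE// g12.
Qed.

(** The adjoint of multiplication by [g], which sends the kernel function at [w] to [conj (g w)]
    times itself. *)
Definition twist g v : seq (R[i] * T) := [seq (x.1 * Num.conj (g x.2), x.2) | x <- v].

Lemma twist_nodes g v : nodes_in Omega v -> nodes_in Omega (twist g v).
Proof. by move=> Ov _ /mapP[x xv ->]; exact: Ov xv. Qed.

Lemma dot_kernel_comb v : nodes_in Omega v ->
  inner H (kernel_comb H v) (kernel_comb H v) =
  \sum_(x <- v) \sum_(y <- v) x.1 * Num.conj y.1 * K y.2 x.2.
Proof.
move=> Ov; rewrite inner_comb// /dual_sum exchange_big/= big_seq [RHS]big_seq.
apply: eq_bigr => y yv; rewrite fun_of_sum; last exact: Ov.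
rewrite mulr_sumr big_seq [RHS]big_seq; apply: eq_bigr => x xv.
rewrite -reproducing; last exact: Ov.
rewrite linearZl_LR/= reproducing; last exact: Ov.
by rewrite kernel_atE; [ring|exact: Ov|exact: Ov].
Qed.

(** Written out over the nodes, the difference of the two sides is the double sum of the positive
    kernel. *)
Lemma rnorm_twist_le g (M : R) v :
  positive_kernel Omega (fun z w => (M%:C - g z * Num.conj (g w)) * K z w) ->
  nodes_in Omega v ->
  rnorm (kernel_comb H (twist g v)) ^+ 2 <= M * rnorm (kernel_comb H v) ^+ 2.
Proof.
move=> posM Ov; have inner_normH := @inner_norm _ _ _ _ H.
rewrite -lecR [(M * _)%:C]rmorphM/= -!(dot_rnorm inner_normH) !dot_kernel_comb//;
  last exact: twist_nodes.
rewrite -subr_ge0; apply: le_trans (posM v Ov) _.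
rewrite big_map mulr_sumr -sumrB le_eqVlt; apply/orP; left; apply/eqP.
apply: eq_bigr => x _; rewrite big_map mulr_sumr -sumrB.
by apply: eq_bigr => y _ /=; rewrite rmorphM/= conjCK; ring.
Qed.

Lemma dual_sum_mul_le g f (M : R) v : 0 <= M ->
  positive_kernel Omega (fun z w => (M%:C - g z * Num.conj (g w)) * K z w) ->
  nodes_in Omega v ->
  `|dual_sum (fun w => g w * fun_of f w) v| <=
    (Num.sqrt M * rnorm f * rnorm (kernel_comb H v))%:C.
Proof.
move=> M0 posM Ov; have inner_normH := @inner_norm _ _ _ _ H.
have -> : dual_sum (fun w => g w * fun_of f w) v = inner H f (kernel_comb H (twist g v)).
  rewrite inner_comb; last exact: twist_nodes.
  by rewrite /dual_sum big_map; apply: eq_bigr => x _; rewrite rmorphM/= conjCK mulrA.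
apply: le_trans (dot_Cauchy_Schwarz inner_normH _ _) _; rewrite lecR.
rewrite [Num.sqrt M * _]mulrC -mulrA ler_wpM2l ?rnorm_ge0//.
rewrite -(@ler_pXn2r _ 2) ?nnegrE ?mulr_ge0 ?sqrtr_ge0 ?rnorm_ge0//.
by rewrite exprMn sqr_sqrtr//; exact: rnorm_twist_le.
Qed.

Lemma positive_multiplier g (M : R) : 0 <= M ->
  positive_kernel Omega (fun z w => (M%:C - g z * Num.conj (g w)) * K z w) ->
  multiplier g.
Proof.
move=> M0 posM f.
by have [h hE] := interpolation (fun v Ov => dual_sum_mul_le f M0 posM Ov); exists h.
Qed.

(* Neumann series for (a - b g)^-1; the hypothesis on the powers of g says that
   g ^ l multiplies with norm at most sqrt(c) r^l. *)
Lemma resolvent_multiplier g (a b : R[i]) (c r : R) : 0 <= c -> 0 <= r ->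
  (forall l, positive_kernel Omega
    (fun z w => ((c * (r ^+ 2) ^+ l)%:C - g z ^+ l * Num.conj (g w ^+ l)) * K z w)) ->
  (forall w, Omega w -> `|g w| <= r%:C) ->
  `|b| * r%:C < `|a| -> multiplier (fun w => (a - b * g w)^-1).
Proof.
move=> c0 r0 posg gr bra f.
have [al al0 aE] := normC_realE a; have [be be0 bE] := normC_realE b.
move: bra; rewrite aE bE -rmorphM ltcR => bra.
have al_gt0 : 0 < al by apply: le_lt_trans bra; rewrite mulr_ge0.
have a0 : a != 0 by rewrite -normr_gt0 aE ltcR.
pose q := be * r / al.
have q0 : 0 <= q by rewrite divr_ge0 ?mulr_ge0.
have q1 : q < 1 by rewrite ltr_pdivrMr// mul1r.
have abg w : Omega w -> a - b * g w != 0.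
  move=> Ow; rewrite subr_eq0; apply: contraTneq bra => ab.
  rewrite -leNgt -lecR -aE ab normrM bE rmorphM ler_wpM2l ?ler0c//; exact: gr.
pose G w := (a - b * g w)^-1 * fun_of f w.
pose t w := b * g w / a.
have tq w : Omega w -> `|t w| <= q%:C.
  move=> Ow; rewrite /t normrM normfV normrM aE bE /q rmorphM fmorphV rmorphM.
  rewrite ler_wpM2r ?invr_ge0 ?ler0c//.
  by rewrite ler_wpM2l ?ler0c//; exact: gr.
(* Finite geometric expansion with exact remainder, as an identity between values at points of
   [Omega]. *)
have Gsplit N w : Omega w -> G w =
    \sum_(l < N) b ^+ l / a ^+ l.+1 * (g w ^+ l * fun_of f w) + t w ^+ N * G w.
  move=> Ow; apply: (mulfI (abg w Ow)); rewrite mulrDr.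
  have -> : (a - b * g w) * \sum_(l < N) b ^+ l / a ^+ l.+1 * (g w ^+ l * fun_of f w) =
      (1 - t w ^+ N) * fun_of f w.
    elim: N => [|N IH]; first by rewrite big_ord0 mulr0 expr0 subrr mul0r.
    rewrite big_ord_recr/= mulrDr IH.
    have -> : b ^+ N / a ^+ N.+1 * (g w ^+ N * fun_of f w) = t w ^+ N * (fun_of f w / a).
      by rewrite /t !exprMn exprVn exprS; field; rewrite a0 expf_neq0.
    have -> : b * g w = t w * a by rewrite /t divfK.
    by rewrite exprS; field.
  have abG : (a - b * g w) * G w = fun_of f w by rewrite /G mulrA mulfV ?abg// mul1r.
  by rewrite [X in _ = _ + X]mulrCA abG; ring.
apply: (@interpolation _ _ _ _ H G ((1 - q)^-1 * (al^-1 * (Num.sqrt c * rnorm f)))) =>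
  v Ov.
(* [B] depends on [v], but it enters only with the factor [q ^+ N], and [N] tends to infinity for
   fixed [v]; the remaining constant [C] is uniform in [v]. *)
pose B := \sum_(x <- v) complex.Re `|x.1 * G x.2|.
have BE : B%:C = \sum_(x <- v) `|x.1 * G x.2|.
  by rewrite rmorph_sum; apply: eq_bigr => x _; exact/RRe_real/normr_real.
set C := (_ * (al^-1 * _)); set k := rnorm _.
suff bound N : `|dual_sum G v| <= (C * k + q ^+ N * B)%:C.
  have [d d0 dE] := normC_realE (dual_sum G v).
  have lim : (fun N => C * k + q ^+ N * B) @ \oo --> C * k.
    rewrite -[X in _ --> X]addr0; apply: cvgD; first exact: cvg_cst.
    by rewrite -[X in _ --> X](mul0r B); apply: cvgMr_tmp; apply: cvg_expr;
      rewrite ger0_norm.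
  rewrite dE lecR -(cvg_lim (@Rhausdorff R) lim).
  apply: limr_ge; first exact: cvgP lim.
  by near=> N; rewrite -lecR -dE.
have -> : dual_sum G v =
    \sum_(l < N) b ^+ l / a ^+ l.+1 * dual_sum (fun w => g w ^+ l * fun_of f w) v +
    dual_sum (fun w => t w ^+ N * G w) v.
  rewrite /dual_sum; under [X in X + _]eq_bigr do rewrite mulr_sumr.
  rewrite exchange_big -big_split/= big_seq [RHS]big_seq; apply: eq_bigr => x xv.
  rewrite {1}(Gsplit N); last exact: Ov.
  rewrite mulrDr mulr_sumr; congr (_ + _); apply: eq_bigr => l _; ring.
apply: le_trans (ler_normD _ _) _; rewrite rmorphD lerD//.
  apply: le_trans (ler_norm_sum _ _ _) _.
  apply: (@le_trans _ _ (\sum_(l < N) q ^+ l * (al^-1 * (Num.sqrt c * rnorm f)) * k)%:C).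
    rewrite rmorph_sum/=; apply: ler_sum => l _.
    rewrite !normrM normfV !normrX aE bE.
    have r2l : 0 <= c * (r ^+ 2) ^+ l by rewrite mulr_ge0 ?exprn_ge0.
    have := dual_sum_mul_le f r2l (posg l) Ov; rewrite -/k.
    rewrite sqrtrM// -exprM mulnC exprM sqrtr_sqr (ger0_norm (exprn_ge0 l r0)) => h.
    apply: le_trans (ler_wpM2l _ h) _.
      by rewrite mulr_ge0 ?invr_ge0 ?exprn_ge0 ?ler0c.
    rewrite -!rmorphXn -fmorphV -!rmorphM/= lecR le_eqVlt; apply/orP; left; apply/eqP.
    by rewrite /q !exprMn exprVn exprS; field; rewrite expf_neq0 ?gt_eqF.
  rewrite lecR -!mulr_suml ler_wpM2r ?rnorm_ge0// /C ler_wpM2r//.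
    by rewrite !mulr_ge0 ?invr_ge0 ?sqrtr_ge0 ?rnorm_ge0.
  rewrite -[leRHS]mul1r ler_pdivlMr ?subr_gt0// mulrBr mulr1.
  have -> : (\sum_(l < N) q ^+ l) - (\sum_(l < N) q ^+ l) * q = 1 - q ^+ N.
    by have := subrX1 q N; rewrite mulrBl mul1r mulrC => h; lra.
  by rewrite gerBl exprn_ge0.
rewrite rmorphM/= BE mulr_sumr; apply: le_trans (ler_norm_sum _ _ _) _.
rewrite big_seq [leRHS]big_seq; apply: ler_sum => x xv.
rewrite !normrM norm_conjC normrX mulrCA.
rewrite ler_wpM2r ?mulr_ge0// rmorphXn lerXn2r ?nnegrE ?normr_ge0 ?ler0c//; apply: tq;
  exact: Ov.
Unshelve. all: by end_near. Qed.

End Multipliers.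

(** * Koszul complexes and the Taylor spectrum *)

Section Koszul.
Context {F : numFieldType} {V : lmodType F} {n : nat}.
Implicit Types (D B : 'I_n -> V -> V) (S : {set 'I_n}) (c : {ffun {set 'I_n} -> V}).

Let sgn (i : 'I_n) S : F := (-1) ^+ #|[set j in S | (j < i)%N]|.

Let sgnD1 i j S : i \in S -> sgn j (S :\ i) = (-1) ^+ (i < j)%N * sgn j S.
Proof.
move=> iS; rewrite /sgn (cardsD1 i [set k in S | (k < j)%N]) inE iS /=.
rewrite exprD mulrA -expr2 sqrr_sign mul1r; congr (_ ^+ #|pred_of_set _|).
by apply/setP => k; rewrite !inE andbA.
Qed.

Let sgnU1 i j S : j \notin S -> sgn i (j |: S) = (-1) ^+ (j < i)%N * sgn i S.
Proof.
move=> jS; rewrite -[S in RHS](finset.setU1K jS) sgnD1 ?finset.setU11// mulrA -expr2.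
by rewrite sqrr_sign mul1r.
Qed.

Let sgn_sq i S : sgn i S * sgn i S = 1.
Proof. by rewrite -expr2 sqrr_sign. Qed.

Let sign_ltn (i j : 'I_n) : i != j -> (-1) ^+ (j < i)%N = - (-1) ^+ (i < j)%N :> F.
Proof.
rewrite -val_eqE; case: ltngtP => //= _ _; by rewrite ?expr0 ?expr1 ?opprK.
Qed.

Definition linear_ops D := forall i a x y, D i (a *: x + y) = a *: D i x + D i y.

Definition commuting_ops D B := forall i j x, D i (B j x) = B j (D i x).

Lemma linear_ops0 D i : linear_ops D -> D i 0 = 0.
Proof. by move=> /(_ i (-1) 0 0); rewrite scaler0 addr0 scaleN1r addNr. Qed.

Lemma linear_opsZ D i a x : linear_ops D -> D i (a *: x) = a *: D i x.
Proof. by move=> Dlin; rewrite -[a *: x]addr0 Dlin linear_ops0// addr0. Qed.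

Lemma linear_ops_sum D i (I : finType) (P : pred I) (E : I -> V) : linear_ops D ->
  D i (\sum_(j | P j) E j) = \sum_(j | P j) D i (E j).
Proof.
move=> Dlin; apply: (big_morph (D i)) => [x y|]; last exact: linear_ops0.
by rewrite -[x in LHS]scale1r Dlin scale1r.
Qed.

Let koszulE D c S : koszul D c S = \sum_(i in S) sgn i S *: D i (c (S :\ i)).
Proof. by rewrite ffunE. Qed.

(** Exchanging the two removed indices reverses the sign while the operators commute, so the double
    sum equals its own negative; the scalars have characteristic 0. *)
Lemma koszul_koszul D c : linear_ops D -> commuting_ops D D -> koszul D (koszul D c) = 0.
Proof.
move=> Dlin Dcomm; apply/ffunP => S; rewrite !ffunE.
pose a i j := (sgn i S * sgn j (S :\ i)) *: D i (D j (c (S :\ i :\ j))).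
rewrite (_ : \sum_(i in S) _ = \sum_(i in S) \sum_(j in S | j != i) a i j); last first.
  apply: eq_bigr => i iS; rewrite ffunE linear_ops_sum// scaler_sumr.
  apply: eq_big => j; first by rewrite !inE andbC.
  by move=> _; rewrite linear_opsZ// scalerA.
set X := LHS; have XN : X = - X.
  rewrite {1}/X (exchange_big_dep (mem S))/= => [|i j _ /andP[]//].
  rewrite -sumrN; apply: eq_bigr => j jS; rewrite -sumrN.
  apply: eq_big => [i|i /and3P[iS _ ji]]; first by rewrite jS eq_sym.
  rewrite /a !sgnD1// (sign_ltn ji) Dcomm -scaleNr finset.setDDl finset.setUC
    -finset.setDDl; congr (_ *: _).
  ring.
have : 2%:R *: X = 0 by rewrite scaler_nat mulr2n {1}XN addNr.
by move/eqP; rewrite scaler_eq0 pnatr_eq0/= => /eqP.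
Qed.

(* Contracting homotopy c |-> sum over i of B_i times the contraction by e_i. *)
Lemma bezout_koszul_exact D B : linear_ops D -> linear_ops B ->
  commuting_ops D D -> commuting_ops D B ->
  (forall x, \sum_i B i (D i x) = x) -> koszul_exact D.
Proof.
move=> Dlin Blin Dcomm DB BD1; apply/seteqP; split => [c /= dc0|_ [c _ <-]]; last first.
  exact: koszul_koszul.
pose hc := [ffun S : {set 'I_n} => \sum_(i | i \notin S) sgn i S *: B i (c (i |: S))] :
  {ffun {set 'I_n} -> V}.
exists hc => //; apply/ffunP => S.
(* This zero is [h (d c)]; added to [d (h c)], it exhibits the homotopy formula
   [d h + h d = sum_i B_i D_i]. *)
have hdc : \sum_(j | j \notin S) sgn j S *: B j (koszul D c (j |: S)) = 0.
  by rewrite big1// => j _; rewrite dc0 ffunE linear_ops0// scaler0.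
rewrite -[RHS]BD1 -[LHS]addr0 -[X in _ + X = _]hdc [RHS](bigID (mem S))/=.
(* The off-diagonal terms, which occur with opposite signs in [d h] and [h d]. *)
pose a i j := (sgn i S * sgn j (S :\ i)) *: D i (B j (c (j |: S :\ i))).
have -> : koszul D hc S = \sum_(i in S) B i (D i (c S)) +
    \sum_(i in S) \sum_(j | j \notin S) a i j.
  rewrite ffunE -big_split/=; apply: eq_bigr => i iS.
  rewrite ffunE linear_ops_sum// scaler_sumr (bigD1 i)/=; last by rewrite finset.setD11.
  rewrite finset.setD1K// linear_opsZ// scalerA; congr (_ + _).
    by rewrite sgnD1// ltnn expr0 mul1r sgn_sq scale1r DB.
  apply: eq_big => j; last by move=> _; rewrite linear_opsZ// scalerA.
  by rewrite !inE; have [->|] := eqVneq j i; rewrite ?iS// andbT.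
have -> : \sum_(j | j \notin S) sgn j S *: B j (koszul D c (j |: S)) =
    \sum_(j | j \notin S) B j (D j (c S)) - \sum_(i in S) \sum_(j | j \notin S) a i j.
  rewrite [X in _ - X]exchange_big/= -sumrN -big_split/=; apply: eq_bigr => j jS.
  have BD x y : B j (x + y) = B j x + B j y by rewrite -[x in LHS]scale1r Blin scale1r.
  rewrite koszulE (bigD1 j)/= ?finset.setU11// BD scalerDr linear_opsZ// scalerA
    finset.setU1K//.
  rewrite sgnU1// ltnn expr0 mul1r sgn_sq scale1r; congr (_ + _).
  rewrite linear_ops_sum// scaler_sumr -sumrN; apply: eq_big => [i|i /andP[+ ij]].
    by rewrite !inE; have [->|] := eqVneq i j; rewrite ?(negbTE jS)// andbT.
  rewrite !inE (negbTE ij)/= => iS.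
  rewrite /a linear_opsZ// scalerA sgnU1// sgnD1// (sign_ltn ij) -scaleNr DB.
  have -> : (j |: S) :\ i = j |: S :\ i.
    by apply/setP => k; rewrite !inE; have [->|//] := eqVneq k i; rewrite (negbTE ij).
  by congr (_ *: _); ring.
by rewrite addrACA subrr addr0.
Qed.

(** Exactness in top degree: a chain supported on the full set is a cocycle, because no [S :\ i]
    with [i] in [S] is full. *)
Lemma koszul_exact_onto D x : linear_ops D -> koszul_exact D ->
  exists y : 'I_n -> V, x = \sum_i D i (y i).
Proof.
move=> Dlin /seteqP[ex _]; pose full := finset.setTfor 'I_n.
pose c := [ffun S : {set 'I_n} => if S == full then x else 0] : {ffun {set 'I_n} -> V}.
have /ex[d _ dc] : koszul D c = 0.
  apply/ffunP => S; rewrite !ffunE big1// => i iS.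
  rewrite ffunE ifF ?linear_ops0 ?scaler0//; apply/negbTE/eqP => /setP/(_ i).
  by rewrite !inE eqxx.
exists (fun i => sgn i full *: d (full :\ i)).
have := congr1 (fun f : {ffun _ -> _} => f full) dc.
rewrite !ffunE eqxx => <-; apply: eq_big => [i|i _]; first by rewrite inE.
by rewrite linear_opsZ.
Qed.

End Koszul.

(** * Criteria for the Taylor spectrum of coordinate multiplications *)

Section CoordinateMultipliers.
Context {R : realType} {n : nat} {Omega : set 'rV[R[i]]_n}
  {K : 'rV[R[i]]_n -> 'rV[R[i]]_n -> R[i]} (H : rkhs Omega K).
Local Notation T := 'rV[R[i]]_n.

Lemma mult_opE (g : T -> R[i]) (f : H) w : multiplier H g -> Omega w ->
  fun_of (mult_op H g f) w = g w * fun_of f w.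
Proof.
move=> mg Ow; have [h hE] := mg f.
have P0 : [set h : H | forall z, Omega z -> fun_of h z = g z * fun_of f z] h by [].
by have /= := xgetPex 0 (ex_intro _ h P0); apply.
Qed.

Hypothesis coord_multiplier : forall i : 'I_n, multiplier H (fun z => z 0 i).
Variable lam : T.

Let D (i : 'I_n) (f : H) : H := Mz H i f - lam 0 i *: f.

Let fun_ofD i f w : Omega w -> fun_of (D i f) w = (w 0 i - lam 0 i) * fun_of f w.
Proof. by move=> Ow; rewrite fun_ofB// fun_ofZ// mult_opE// mulrBl. Qed.

Let D_linear : linear_ops D.
Proof.
move=> i a f g; apply: fun_of_inj => w Ow.
by rewrite fun_ofD// !fun_of_linear// !fun_ofD//; ring.
Qed.

(** All operators are multiplications, so linearity, commutation and the Bezout relation are checked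
    on values at points and lifted by [fun_of_inj]. *)
Lemma bezout_not_taylor_spectrum (g : 'I_n -> T -> R[i]) :
  (forall i, multiplier H (g i)) ->
  (forall w, Omega w -> \sum_i g i w * (w 0 i - lam 0 i) = 1) ->
  ~ taylor_spectrum (Mz H) lam.
Proof.
move=> mg g1; apply.
apply: (@bezout_koszul_exact _ _ _ D (fun i f => mult_op H (g i) f)) => //.
- move=> i a f h; apply: fun_of_inj => w Ow.
  by rewrite mult_opE// !fun_of_linear// !mult_opE//; ring.
- by move=> i j f; apply: fun_of_inj => w Ow; rewrite !fun_ofD//; ring.
- by move=> i j f; apply: fun_of_inj => w Ow; rewrite fun_ofD// !mult_opE// fun_ofD//;
    ring.
move=> f; apply: fun_of_inj => w Ow; rewrite fun_of_sum//.
rewrite -[RHS]mul1r -(g1 w Ow) mulr_suml; apply: eq_bigr => i _.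
by rewrite mult_opE// fun_ofD// mulrA.
Qed.

(* The series of normalised kernels g = sum_k 2^-k k_(u k) / |k_(u k)| satisfies
   |g (u l)| >= 2^-l |k_(u l)|, as its terms are nonnegative at u l, whereas
   functions in the sum of the ranges of the M_(z_i) - lam_i are
   O(4^-l |k_(u l)|) there. *)
Lemma approx_taylor_spectrum (u : nat -> T) :
  (forall k, Omega (u k)) -> (forall k l, 0 < K (u k) (u l)) ->
  (forall k i, `|u k 0 i - lam 0 i| <= (4 ^- k)%:C) ->
  taylor_spectrum (Mz H) lam.
Proof.
move=> Ou Kpos ulam /= ex; have inner_normH := @inner_norm _ _ _ _ H.
pose e k := kernel_at H (u k); pose kap k := rnorm (e k).
have KE k : K (u k) (u k) = (kap k ^+ 2)%:C.
  by rewrite -(dot_rnorm inner_normH) reproducing// kernel_atE.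
have kap_gt0 k : 0 < kap k.
  rewrite lt_def rnorm_ge0 andbT; apply/eqP => k0.
  by have := Kpos k k; rewrite KE k0 expr0n ltxx.
pose t k := (2 ^- k / kap k)%:C *: e k.
have t_norm k : `|t k| = (2 ^- k)%:C.
  rewrite normrZ rnormE -/(kap k) ger0_norm; last first.
    by rewrite ler0c divr_ge0 ?invr_ge0 ?exprn_ge0 ?rnorm_ge0.
  by rewrite -rmorphM divfK// gt_eqF.
have [g tg] : exists g : H, (fun N => \sum_(k < N) t k) @ \oo --> g.
  suff /cvg_ex[g tg] : cvg ((fun N => \sum_(k < N) t k) @ \oo) by exists g.
  apply: (@cauchy_cvg_norm _ _ _ (fun k => 2 * 2 ^- k)) => [i j ij|].
    rewrite distrC -(subnKC ij) big_split_ord/= addrAC subrr add0r.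
    apply: le_trans (ler_norm_sum _ _ _) _.
    rewrite (eq_bigr (fun k : 'I_(j - i) => (2 ^- i * 2^-1 ^+ k)%:C)); last first.
      by move=> k _; rewrite t_norm exprD invfM exprVn.
    rewrite -rmorph_sum/= lecR -mulr_sumr mulrC ler_wpM2r ?invr_ge0 ?exprn_ge0//.
    by apply: sum_expr_le2; rewrite ?invr_ge0.
  apply: cvg_trans (cvg_geometric (2 : R) (_ : `|2^-1| < 1)); last first.
    by rewrite ger0_norm ?invr_ge0// invf_lt1// ltr1n.
  by apply: near_eq_cvg; near=> k; rewrite /= exprVn.
have g_ge l : 2 ^- l * kap l <= complex.Re (fun_of g (u l)).
  have lim := cvg_Re (cvg_fun_of (Ou l) tg).
  rewrite -(cvg_lim (@Rhausdorff R) lim); apply: limr_ge; first exact: cvgP lim.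
  near=> N.
  have lN : (l < N)%N by near: N; exists l.+1.
  rewrite fun_of_sum// raddf_sum (bigD1 (Ordinal lN))//= fun_ofZ//.
  have tE k : fun_of (t k) (u l) = (2 ^- k / kap k)%:C * K (u l) (u k).
    by rewrite fun_ofZ// kernel_atE.
  rewrite -[leLHS]addr0 lerD//.
    rewrite kernel_atE// KE -rmorphM/= expr2 mulrA divfK// gt_eqF//.
  apply: sumr_ge0 => k _; rewrite tE -ler0c RRe_real.
    by rewrite mulr_ge0 ?(ltW (Kpos _ _))// ler0c divr_ge0 ?invr_ge0 ?exprn_ge0
      ?rnorm_ge0.
  by rewrite ger0_real// mulr_ge0 ?(ltW (Kpos _ _))// ler0c divr_ge0 ?invr_ge0
    ?exprn_ge0 ?rnorm_ge0.
have [y gy] := koszul_exact_onto g D_linear ex.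
pose Y := \sum_i rnorm (y i).
have Y_ge0 : 0 <= Y by apply: sumr_ge0 => i _; exact: rnorm_ge0.
have gle l : complex.Re (fun_of g (u l)) <= 4 ^- l * Y * kap l.
  apply: le_trans (ler_norm _) _; rewrite -lecR; apply: le_trans (normc_ge_Re _) _.
  rewrite gy fun_of_sum//; apply: le_trans (ler_norm_sum _ _ _) _.
  rewrite mulr_sumr mulr_suml rmorph_sum/=; apply: ler_sum => i _.
  rewrite fun_ofD// normrM -mulrA rmorphM ler_pM//.
  exact: fun_of_le.
(* Then [Y < l < 2^l], whereas the two estimates at [u l] give [2^l <= Y]. *)
pose l := Num.bound Y.
have e4 : (4 : R) ^- l = 2 ^- l * 2 ^- l.
  by rewrite -invfM -exprMn; congr ((_ ^+ l)^-1); rewrite -natrM.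
have := le_trans (g_ge l) (gle l); rewrite ler_pM2r// e4 -mulrA -[leLHS]mulr1.
rewrite ler_pM2l ?invr_gt0 ?exprn_gt0// mulrC ler_pdivlMr ?exprn_gt0// mul1r.
rewrite leNgt => /negP; apply; apply: lt_trans (archi_boundP Y_ge0) _.
by rewrite -natrX ltr_nat ltn_expl.
Unshelve. all: by end_near. Qed.

End CoordinateMultipliers.

(** * The triangle and its kernel *)

Section ShiftedSeries.
Context {R : realType} (p : {poly R}).
Hypotheses (p_ge0 : forall i, 0 <= p`_i) (p0 : p`_0 = 0) (p1 : 0 < p`_1).
Variable (s0 : R).
Hypotheses (s0_gt0 : 0 < s0) (ps0 : p.[s0] = 1).
Local Notation g := (inv_pow_coef p).

(** By the shift bound the coefficients [d k] are nonnegative, which is the source of positivity for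
    the powers of [phi_j]. The constant [c] serves all [l] at once, as the Neumann series
    requires. *)
Lemma inv_pow_coef_shift_series m : exists2 c : R, 0 < c &
  forall l, exists2 d : nat -> R, forall k, 0 <= d k &
    forall x : R[i], `|x| < s0%:C -> series (fun k => (d k)%:C * x ^+ k) @ \oo -->
      ((c * s0 ^+ l)%:C - x ^+ l) * (1 - (map_poly (real_complex R) p).[x]) ^- m.+1.
Proof.
have [c c0 gc] := inv_pow_coef_shift p_ge0 p0 p1 s0_gt0 ps0 m.
exists c => // l; have cs0 : 0 < c * s0 ^+ l by rewrite mulr_gt0 ?exprn_gt0.
pose d k := c * s0 ^+ l * g m.+1 k - (if (k < l)%N then 0 else g m.+1 (k - l)).
exists d => [k|x xs0].
  rewrite /d; case: ltnP => kl; first by rewrite subr0 mulr_ge0 ?(ltW cs0)//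
    inv_pow_coef_ge0.
  by have := gc (k - l)%N l; rewrite subnK// subr_ge0.
have S := inv_pow_coef_series p_ge0 p0 p1 s0_gt0 ps0 (m := m.+1) xs0.
pose a k := (g m.+1 k)%:C * x ^+ k.
pose b k : R[i] := (if (k < l)%N then 0 else g m.+1 (k - l))%:C * x ^+ k.
have Sb : series b @ \oo --> x ^+ l * (1 - (map_poly (real_complex R) p).[x]) ^- m.+1.
  rewrite -(cvg_shiftn l); apply: cvg_trans (cvgMl_tmp (a := x ^+ l) S).
  apply: near_eq_cvg; near=> N; rewrite /= !seriesEnat/= !big_mkord addnC big_split_ord/=.
  rewrite [X in _ = X + _]big1 ?add0r => [|i _]; last by rewrite /b ltn_ord mul0r.
  rewrite mulr_sumr; apply: eq_bigr => i _.
  by rewrite /b ltnNge leq_addr/= addKn exprD mulrCA.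
rewrite mulrBl; apply: cvg_trans (cvgB (cvgMl_tmp (a := (c * s0 ^+ l)%:C) S) Sb).
apply: near_eq_cvg; near=> N.
suff -> : series (fun k => (d k)%:C * x ^+ k) N =
    (c * s0 ^+ l)%:C * series a N - series b N by [].
rewrite !seriesEnat/= mulr_sumr -sumrB; apply: eq_bigr => k _.
by rewrite /a /b /d rmorphB rmorphM mulrBl mulrA.
Unshelve. all: by end_near. Qed.

End ShiftedSeries.

Section RootExists.
Context {R : realType} (p : {poly R}).
Hypotheses (p_ge0 : forall i, 0 <= p`_i) (p0 : p`_0 = 0) (p1 : 0 < p`_1).

Lemma horner_ge_linear (s : R) : 0 <= s -> p`_1 * s <= p.[s].
Proof.
move=> s0; rewrite horner_coef.
have sp : (1 < size p)%N.
  by rewrite ltnNge; apply/negP => /leq_sizeP/(_ _ (leqnn 1)) h; move: p1; rewrite h ltxx.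
rewrite (bigD1 (Ordinal sp))//= expr1 lerDl sumr_ge0// => i _.
by rewrite mulr_ge0 ?exprn_ge0.
Qed.

Lemma horner_eq1_exists : exists2 s : R, 0 < s & p.[s] = 1.
Proof.
(* The linear term alone reaches 1 at [b], so the intermediate value theorem applies to [p - 1]
   between 0 and [b]. *)
pose b := (p`_1)^-1; have b0 : 0 <= b by rewrite invr_ge0 ltW.
have [|s /andP[s_ge0 _] /rootP] := @poly_ivt _ (p - 1) 0 b b0.
  rewrite !hornerE horner_coef0 p0 sub0r oppr_le0 ler01/= subr_ge0.
  by apply: le_trans (horner_ge_linear b0); rewrite mulfV// gt_eqF.
rewrite !hornerE => /eqP; rewrite subr_eq0 => /eqP ps; exists s => //.
rewrite lt_def s_ge0 andbT; apply: contra_eq_neq ps => ->.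
by rewrite horner_coef0 p0 eq_sym oner_eq0.
Qed.

Lemma horner_lt1 (s0 s : R) : 0 < s0 -> p.[s0] = 1 -> 0 <= s -> (p.[s] < 1) = (s < s0).
Proof.
move=> s0_gt0 ps0 s_ge0; apply/idP/idP; last exact: poly_ltr_s0.
apply: contraTT; rewrite -!leNgt => ss0; rewrite -ps0 !horner_coef.
by apply: ler_sum => i _; rewrite ler_wpM2l// lerXn2r ?nnegrE ?(ltW s0_gt0).
Qed.

End RootExists.

(** * Reduction of an admissible tuple to real polynomials in one variable *)

Section Univariate.
Context {R : realType} {n : nat}.
Local Notation C := R[i].

Lemma meval_at0 (p : mpoly.mpoly n C) : peval p 0 = mpoly.mcoeff mpoly.mnm0 p.
Proof.
rewrite /peval mpoly.mevalE.
rewrite (eq_bigr (fun m => mpoly.mcoeff m p * (m == mpoly.mnm0)%:R)); last first.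
  move=> m _; congr (_ * _); have [->|m0] := eqVneq m mpoly.mnm0.
    by rewrite big1// => i _; rewrite mpoly.mnm0E.
  have [i mi] : exists i, m i != 0%N.
    apply/existsP; apply: contra_neqT m0 => /existsPn m0; apply/mpoly.mnmP => i.
    by rewrite mpoly.mnm0E; apply/eqP; rewrite -[_ == _]negbK; exact: m0.
  by rewrite (bigD1 i)//= mxE expr0n (negbTE mi) mul0r.
have [m0|m0] := boolP (mpoly.mnm0 \in mpoly.msupp p).
  rewrite (bigD1_seq mpoly.mnm0) ?mpoly.msupp_uniq//= eqxx mulr1 big1 ?addr0// => m.
  by move=> /negbTE ->; rewrite mulr0.
rewrite big_seq big1 => [|m mp]; first by rewrite mpoly.memN_msupp_eq0.
have [mE|] := eqVneq m mpoly.mnm0; last by rewrite mulr0.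
by move: m0; rewrite -mE mp.
Qed.

(** On the support of [P j] a monomial is determined by its exponent at [j], so each coefficient of
    [q] comes from a single monomial. *)
Lemma univariate (P : 'I_n -> mpoly.mpoly n C) (j : 'I_n) : admissible P ->
  exists q : {poly R}, [/\ forall i, 0 <= q`_i, q`_0 = 0, 0 < q`_1,
    forall z, peval (P j) z = (map_poly (real_complex R) q).[z 0 j] &
    peval (mpoly.mderiv j (P j)) 0 = (q`_1)%:C].
Proof.
move=> /(_ j)[P_ge0 P0 [a a0 P1] Pj].
pose q := \sum_(m <- mpoly.msupp (P j)) complex.Re (mpoly.mcoeff m (P j)) *: 'X^(m j).
have qE i : q`_i = \sum_(m <- mpoly.msupp (P j)) complex.Re (mpoly.mcoeff m (P j)) * (i
  == m j)%:R.
  by rewrite coef_sum; apply: eq_bigr => m _; rewrite coefZ coefXn.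
have cE m : (complex.Re (mpoly.mcoeff m (P j)))%:C = mpoly.mcoeff m (P j).
  by rewrite RRe_real// ger0_real.
have mE (m : mpoly.multinom n) (k : nat) : m \in mpoly.msupp (P j) -> m j = k ->
    m = mpoly.mnm_muln (mpoly.mnm1 j) k.
  rewrite mpoly.mcoeff_msupp => mp mk; apply/mpoly.mnmP => i.
  rewrite mpoly.mulmnE mpoly.mnm1E; have [<-|ij] := eqVneq j i; first by rewrite mul1n.
  by rewrite mul0n (Pj m mp) 1?eq_sym.
have q1 : (q`_1)%:C = mpoly.mcoeff (mpoly.mnm1 j) (P j).
  rewrite qE (bigD1_seq (mpoly.mnm1 j)) ?mpoly.msupp_uniq//=; last first.
    by rewrite mpoly.mcoeff_msupp P1 eqxx mulr1n gt_eqF.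
  rewrite mpoly.mnm1E !eqxx mulr1 big_seq_cond big1 ?addr0 ?cE// => m /andP[mp m1].
  rewrite [X in _ * X](_ : _ = 0) ?mulr0//; case: eqP => // m1'.
  by move: m1; rewrite (mE m 1%N mp (esym m1')) eqxx.
exists q; split.
- move=> i; rewrite qE sumr_ge0// => m _; rewrite mulr_ge0 ?ler0n//.
  by rewrite -ler0c cE.
- rewrite qE big_seq big1// => m mp; case: eqP => [m0|]; last by rewrite mulr0.
  by rewrite mulr1 (mE m 0%N mp (esym m0)) P0.
- by rewrite -ltcR q1 P1 eqxx mulr1n.
- move=> z; rewrite /peval mpoly.mevalE /q rmorph_sum/= horner_sum.
  rewrite big_seq [RHS]big_seq; apply: eq_bigr => m mp.
  rewrite map_polyZ map_polyXn hornerZ hornerXn/= cE; congr (_ * _).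
  rewrite (bigD1 j)//= big1 ?mulr1// => i ij.
  by rewrite (Pj m) ?expr0// -mpoly.mcoeff_msupp.
- by rewrite meval_at0 mpoly.mcoeff_deriv q1 mpoly.mnm0E mulr1n;
    congr (mpoly.mcoeff _ _); apply/mpoly.mnmP => i; rewrite mpoly.mnmDE mpoly.mnm0E.
Qed.

End Univariate.

(** * The closure of the triangle and approximation from inside *)

Section TriangleGeometry.
Context {R : realType} {n : nat}.
Local Notation C := R[i].
Local Notation T := 'rV[C]_n.
Implicit Types (z w : T) (r : 'I_n -> R).

(** The counterpart of [next_coord] for the moduli. *)
Definition next_val (x : 'I_n -> R) (j : 'I_n) : R :=
  if (insub j.+1 : option 'I_n) is Some k then x k else 1.

Lemma next_coord_neq0 z j : (forall j : 'I_n, (0 < j)%N -> z 0 j != 0) ->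
  next_coord z j != 0.
Proof.
move=> z0; rewrite /next_coord; case: insubP => [k _ kj|_]; last exact: oner_neq0.
by apply: z0; rewrite kj.
Qed.

Lemma phi_next z j : next_coord z j != 0 -> z 0 j = phi z 0 j * next_coord z j.
Proof. by move=> nz; rewrite mxE divfK. Qed.

Lemma peval_Pr r j z : peval (Pr r j) z = ((r j ^+ 2)^-1)%:C * z 0 j.
Proof. by rewrite /peval mpoly.mevalZ mpoly.mevalXU. Qed.

Lemma diamond_conjE z w j :
  diamond (phi z) (conj_vec (phi w)) 0 j = phi z 0 j * Num.conj (phi w 0 j).
Proof. by rewrite [LHS]mxE; congr (_ * _); rewrite mxE. Qed.

Lemma triangle_PrE r z : (forall j, 0 < r j) -> triangle (Pr r) z <->
  (forall j : 'I_n, (0 < j)%N -> z 0 j != 0) /\ (forall j, `|phi z 0 j| < (r j)%:C).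
Proof.
move=> r0; have E j : (peval (Pr r j) (diamond (phi z) (conj_vec (phi z))) < 1) =
    (`|phi z 0 j| < (r j)%:C).
  rewrite peval_Pr diamond_conjE -normCK; have [a a0 ->] := normC_realE (phi z 0 j).
  rewrite -rmorphXn -rmorphM !ltcR mulrC ltr_pdivrMr ?exprn_gt0// mul1r.
  by rewrite ltr_pXn2r ?nnegrE ?a0 ?(ltW (r0 j)).
by split=> -[z0 zP]; split=> // j; [rewrite -E|rewrite E].
Qed.

Lemma triangle_norm_le r z j : (forall j, 0 < r j) -> triangle (Pr r) z ->
  `|z 0 j| <= (r j)%:C * `|next_coord z j|.
Proof.
move=> r0 /(triangle_PrE _ r0)[z0 zr]; rewrite (phi_next (next_coord_neq0 j z0)) normrM.
by rewrite ler_wpM2r// ltW.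
Qed.

(** On the closure coordinates may vanish and [phi] loses its meaning, hence the product form of the
    inequalities. *)
Lemma closure_triangle_le r z : (forall j, 0 < r j) -> closure (triangle (Pr r)) z ->
  forall j, `|z 0 j| <= (r j)%:C * `|next_coord z j|.
Proof.
move=> r0 zcl j; have [a a0 za] := normC_realE (z 0 j).
have [b b0 zb] := normC_realE (next_coord z j); rewrite za zb -rmorphM lecR.
rewrite leNgt; apply/negP => rba.
(* [e] solves [r_j (b + e) + e = a], so the violation survives a perturbation of both coordinates by
   less than [e]. *)
pose e := (a - r j * b) / (1 + r j).
have r1 : 0 < 1 + r j by rewrite addr_gt0.
have e0 : 0 < e by rewrite divr_gt0// subr_gt0.
have /zcl[w [wt [_ zw]]] : nbhs z (ball z e%:C).
  by apply: nbhsx_ballx; rewrite ltcR.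
have zw' k : `|z 0 k - w 0 k| < e%:C by have := zw 0 k; rewrite -ball_normE.
have nzw : `|next_coord w j| <= `|next_coord z j| + e%:C.
  rewrite /next_coord; case: insubP => [k _ _|_].
    rewrite -(subrK (z 0 k) (w 0 k)) addrC; apply: le_trans (ler_normD _ _) _.
    by rewrite lerD2l distrC ltW.
  by rewrite normr1 lerDl ler0c ltW.
have := triangle_norm_le j r0 wt.
have : `|z 0 j| < `|w 0 j| + e%:C.
  rewrite -{1}(subrK (w 0 j) (z 0 j)) addrC; apply: le_lt_trans (ler_normD _ _) _.
  by rewrite ltrD2l.
have [a' _ ->] := normC_realE (w 0 j).
move: nzw; have [b' _ ->] := normC_realE (next_coord w j).
rewrite za zb -!rmorphD/= -rmorphM !(lecR, ltcR) => h1 h2 h3.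
have : r j * b' <= r j * (b + e) by rewrite ler_pM2l.
have : e * (1 + r j) = a - r j * b by rewrite divfK// gt_eqF.
nra.
Qed.

(* The constraints 0 <= x_j <= r_j x_(j+1) are convex, and y_j = prod_(i >= j) r_i / 2
   satisfies them strictly; the approximating moduli lie on the segment from the
   moduli of z to y, and their arguments are constant. *)
Lemma triangle_approx r z : (forall j, 0 < r j) ->
  (forall j, `|z 0 j| <= (r j)%:C * `|next_coord z j|) ->
  exists2 om : 'I_n -> C, forall j, `|om j| = 1 &
  exists rho : nat -> 'I_n -> R,
    [/\ forall k j, 0 < rho k j,
        forall k j, rho k j < r j * next_val (rho k) j &
        forall k j, `|om j * (rho k j)%:C - z 0 j| <= (4 ^- k)%:C].
Proof.
move=> r0 zr.
have /choice[x xP] : forall j, exists a : R, 0 <= a /\ `|z 0 j| = a%:C.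
  by move=> j; have [a a0 za] := normC_realE (z 0 j); exists a.
have xr j : x j <= r j * next_val x j.
  have := zr j; rewrite (xP j).2 /next_coord /next_val.
  by case: insub => [k|]; rewrite ?(xP k).2 ?normr1 ?mulr1 -?rmorphM lecR// mulr1.
pose y (j : 'I_n) := \prod_(i < n | (j <= i)%N) (r i / 2).
have y0 j : 0 < y j by apply: prodr_gt0 => i _; rewrite divr_gt0.
have yr j : y j = r j / 2 * next_val y j.
  rewrite /y (bigD1 j)//=; congr (_ * _); rewrite /next_val; case: insubP => [k _ kj|].
    by apply: eq_bigl => i; rewrite kj ltn_neqAle andbC eq_sym.
  rewrite -leqNgt => nj; rewrite big1// => i /andP[ji]; rewrite -val_eqE/= => ij.
  have : (i < n)%N by [].
  by rewrite ltnNge (leq_trans nj)// ltn_neqAle eq_sym ij ji.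
pose om j := if z 0 j == 0 then 1 else z 0 j / `|z 0 j|.
have omE j : z 0 j = om j * (x j)%:C.
  rewrite /om -(xP j).2; case: eqP => [->|/eqP z0]; first by rewrite normr0 mulr0.
  by rewrite divfK ?normr_eq0.
have om1 j : `|om j| = 1.
  rewrite /om; case: eqP => [_|/eqP z0]; first by rewrite normr1.
  by rewrite normrM normfV normr_id divff ?normr_eq0.
exists om => //.
pose B := \sum_j `|y j - x j|.
have B0 : 0 <= B by apply: sumr_ge0.
(* Position on the segment: [B] dominates every [|y_j - x_j|], so the displacement is at most
   [4 ^- k], the rate required by [approx_taylor_spectrum]. *)
pose d k : R := 4 ^- k / (B + 1).
have d0 k : 0 < d k by rewrite divr_gt0 ?invr_gt0 ?exprn_gt0// ltr_wpDl.
have d1 k : d k <= 1.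
  rewrite ler_pdivrMr ?ltr_wpDl// mul1r; apply: (@le_trans _ _ 1); last by rewrite lerDr.
  by rewrite invf_le1 ?exprn_gt0// exprn_ege1// ler1n.
exists (fun k j => (1 - d k) * x j + d k * y j).
have rho0 k j : 0 < (1 - d k) * x j + d k * y j.
  apply: ltr_wpDl; last by apply: mulr_gt0.
  by apply: mulr_ge0; [rewrite subr_ge0|exact: (xP j).1].
split=> // k j.
  have -> : next_val (fun j => (1 - d k) * x j + d k * y j) j =
      (1 - d k) * next_val x j + d k * next_val y j.
    by rewrite /next_val; case: insub => // ; rewrite !mulr1 subrK.
  rewrite mulrDr ler_ltD//.
    by rewrite mulrCA ler_wpM2l ?subr_ge0.
  rewrite mulrCA ltr_pM2l// yr ltr_pM2r; last first.
    by have := y0 j; rewrite yr pmulr_rgt0// divr_gt0.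
  by rewrite ltr_pdivrMr// ltr_pMr// ltr1n.
rewrite omE -mulrBr normrM om1 mul1r -rmorphB.
have -> : (1 - d k) * x j + d k * y j - x j = d k * (y j - x j) by ring.
rewrite normc_def/= expr0n addr0 sqrtr_sqr normrM (ger0_norm (ltW (d0 k))).
rewrite lecR /d mulrAC ler_pdivrMr ?ltr_wpDl// ler_wpM2l ?invr_ge0 ?exprn_ge0//.
apply: (@le_trans _ _ B); last by rewrite lerDl.
by rewrite /B (bigD1 j)//= lerDl sumr_ge0.
Qed.

Lemma triangle_polar r (om : 'I_n -> C) (rho : 'I_n -> R) :
  (forall j, 0 < r j) -> (forall j, `|om j| = 1) -> (forall j, 0 < rho j) ->
  (forall j, rho j < r j * next_val rho j) ->
  triangle (Pr r) (\row_j (om j * (rho j)%:C)).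
Proof.
move=> r0 om1 rho0 rhor; apply/triangle_PrE => //.
have nE j : `|next_coord (\row_j (om j * (rho j)%:C) : T) j| = (next_val rho j)%:C.
  rewrite /next_coord /next_val; case: insub => [k|]; last by rewrite normr1.
  by rewrite mxE normrM om1 mul1r ger0_norm// ler0c ltW.
have n0 j : 0 < next_val rho j by rewrite /next_val; case: insub.
split=> j.
  by move=> _; rewrite mxE -normr_gt0 normrM om1 mul1r normr_gt0 gt_eqF// ltcR.
rewrite mxE normrM normfV nE mxE normrM om1 mul1r ger0_norm ?ler0c ?(ltW (rho0 j))//.
by rewrite -fmorphV -rmorphM ltcR ltr_pdivrMr.
Qed.

Lemma le_closure_triangle r z : (forall j, 0 < r j) ->
  (forall j, `|z 0 j| <= (r j)%:C * `|next_coord z j|) -> closure (triangle (Pr r)) z.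
Proof.
move=> r0 zr; have [om om1 [rho [rho0 rhor rhoz]]] := triangle_approx r0 zr.
move=> B /nbhs_ballP[e /= e0 zB].
have [d de] : exists d, e = d%:C by exists (complex.Re e); rewrite RRe_real// gtr0_real.
move: e0; rewrite de ltcR => d0; have dinv0 : 0 <= d^-1 by rewrite invr_ge0 ltW.
pose k := Num.bound d^-1.
have kd : (4 : R) ^- k < d.
  rewrite invf_plt ?posrE ?exprn_gt0//; apply: lt_le_trans (archi_boundP dinv0) _.
  by rewrite -natrX ler_nat ltnW// ltn_expl.
exists (\row_j (om j * (rho k j)%:C)); split; first exact: triangle_polar.
apply: zB; rewrite de; split; first by rewrite ltcR.
move=> i j; rewrite (ord1 i) -ball_normE/= mxE distrC.
by apply: le_lt_trans (rhoz k j) _; rewrite ltcR.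
Qed.

End TriangleGeometry.

(** * Multipliers on the triangle and the two inclusions for the spectrum *)

Section TriangleSpectrum.
Context {R : realType} {n : nat} (P : 'I_n -> mpoly.mpoly n R[i]) (m : 'I_n -> nat).
Local Notation C := R[i].
Local Notation T := 'rV[C]_n.
Variables (q : 'I_n -> {poly R}) (s0 : 'I_n -> R).
Hypotheses (q_ge0 : forall j i, 0 <= (q j)`_i) (q0 : forall j, (q j)`_0 = 0)
  (q1 : forall j, 0 < (q j)`_1)
  (Pq : forall j z, peval (P j) z = (map_poly (real_complex R) (q j)).[z 0 j])
  (s0_gt0 : forall j, 0 < s0 j) (qs0 : forall j, (q j).[s0 j] = 1)
  (m_gt0 : forall j, (0 < m j)%N).
Let r j := Num.sqrt (s0 j).
Let Omega := triangle P.

Let r_gt0 j : 0 < r j. Proof. by rewrite sqrtr_gt0. Qed.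

Let r_sq j : r j ^+ 2 = s0 j. Proof. by rewrite sqr_sqrtr// ltW. Qed.

(** On nonnegative reals [q j] is below 1 exactly before [s0 j = r j ^+ 2], so both sets impose the
    same bound on [phi_j]. *)
Lemma triangle_eq_Pr : triangle P = triangle (Pr r).
Proof.
have E z j : (peval (P j) (diamond (phi z) (conj_vec (phi z))) < 1) =
    (`|phi z 0 j| < (r j)%:C).
  rewrite Pq diamond_conjE -normCK; have [a a0 ->] := normC_realE (phi z 0 j).
  rewrite -rmorphXn horner_map/= !ltcR.
  rewrite (horner_lt1 (q_ge0 j) (q1 j) (s0_gt0 j) (qs0 j)) ?exprn_ge0//.
  by rewrite -r_sq ltr_pXn2r ?nnegrE ?a0 ?(ltW (r_gt0 j)).
apply/seteqP; split=> z.
  by move=> [z0 zP]; apply/triangle_PrE => //; split=> // j; rewrite -E.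
by move=> /triangle_PrE -/(_ r_gt0)[z0 zr]; split=> // j; rewrite E.
Qed.

Let phi_lt z j : Omega z -> `|phi z 0 j| < (r j)%:C.
Proof. by rewrite /Omega triangle_eq_Pr => /triangle_PrE -/(_ r_gt0)[]. Qed.

Let next_neq0 z j : Omega z -> next_coord z j != 0.
Proof. by move=> [z0 _]; exact: next_coord_neq0. Qed.

Let kernelE z w : triangle_kernel P m z w =
  (\prod_(j < n | (0 < j)%N) (z 0 j * Num.conj (w 0 j))^-1) *
  \prod_(j < n) (1 - (map_poly (real_complex R) (q j)).[phi z 0 j * Num.conj (phi w 0
    j)]) ^- m j.
Proof.
by congr (_ * _); apply: eq_bigr => j _; rewrite Pq diamond_conjE.
Qed.

(** Only the factor of index [j] changes, into a series covered by [inv_pow_coef_shift_series]; the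
    other factors are Gram limits too, and products preserve this. It means that [phi_j ^+ l]
    multiplies with norm at most [sqrt(c) r_j^l]. *)
Lemma triangle_kernel_gram j : exists2 c : R, 0 <= c & forall l,
  gram_limit Omega (fun z w =>
    ((c * (r j ^+ 2) ^+ l)%:C - phi z 0 j ^+ l * Num.conj (phi w 0 j ^+ l)) *
    triangle_kernel P m z w).
Proof.
have [c c0 cP] := inv_pow_coef_shift_series (q_ge0 j) (q0 j) (q1 j) (s0_gt0 j) (qs0 j)
  (m j).-1.
exists c => [|l]; first exact: ltW.
have X_lt z w i : Omega z -> Omega w -> `|phi z 0 i * Num.conj (phi w 0 i)| < (s0 i)%:C.
  move=> Oz Ow; rewrite normrM norm_conjC -r_sq expr2 rmorphM.
  by rewrite ltr_pM ?phi_lt.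
pose k1 (z w : T) : C := \prod_(i < n | (0 < i)%N) (z 0 i * Num.conj (w 0 i))^-1.
pose k2 i (z w : T) : C := (1 - (map_poly (real_complex R) (q i)).[phi z 0 i * Num.conj
  (phi w 0 i)]) ^- m i.
pose kj (z w : T) : C := ((c * (r j ^+ 2) ^+ l)%:C - phi z 0 j ^+ l * Num.conj (phi w 0
  j ^+ l)) * k2 j z w.
refine (@gram_limit_ext _ _ Omega (fun z w => k1 z w * (kj z w * \prod_(i | i != j) k2
  i z w)) _ _ _).
  by move=> z w _ _; rewrite kernelE [X in _ = _ * (_ * X)](bigD1 j)//= /kj -!mulrA
    mulrCA.
apply: gram_limitM; last apply: gram_limitM.
- apply: gram_limit_prod => i _; apply: gram_limit_ext (gram_limit_rank1 _ (fun z => (z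
    0 i)^-1)).
  by move=> z w _ _; rewrite fmorphV invfM.
- have [d d_ge0 dP] := cP l.
  apply: (gram_limit_series (g := fun z => phi z 0 j) d_ge0) => z w Oz Ow.
  rewrite /kj /k2 rmorphXn -exprMn r_sq -(prednK (m_gt0 j)).
  by apply: dP; exact: X_lt.
- apply: gram_limit_prod => i _.
  apply: (gram_limit_series (g := fun z => phi z 0 i) (inv_pow_coef_ge0 (q_ge0 i) (q0
    i) (m i))).
  by move=> z w Oz Ow; apply: (inv_pow_coef_series (q_ge0 i) (q0 i) (q1 i) (s0_gt0 i)
    (qs0 i)); exact: X_lt.
Qed.

Variable H : rkhs (triangle P) (triangle_kernel P m).

Lemma phi_multiplier j : multiplier H (fun z => phi z 0 j).
Proof.
have [c c0 cP] := triangle_kernel_gram j.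
apply: (positive_multiplier (M := c * (r j ^+ 2) ^+ 1));
  first by rewrite mulr_ge0// exprn_ge0// sqr_ge0.
have := gram_limit_positive (cP 1%N); congr (positive_kernel _ _).
Qed.

Lemma phi_resolvent_multiplier j (a b : C) : `|b| * (r j)%:C < `|a| ->
  multiplier H (fun z => (a - b * phi z 0 j)^-1).
Proof.
have [c c0 cP] := triangle_kernel_gram j => ba.
apply: (resolvent_multiplier c0 (ltW (r_gt0 j)) _ _ ba) => [l|z Oz].
  exact: gram_limit_positive (cP l).
exact/ltW/phi_lt.
Qed.

Lemma coord_multiplier_triangle j : multiplier H (fun z => z 0 j).
Proof.
(* Descending induction on [j] through [z_j = phi_j z_(j+1)], where the factor after the last index
   is 1. *)
have [k] := ubnP (n - j); elim: k j => // k IH j; rewrite ltnS => njk.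
apply: (@multiplier_ext _ _ _ _ H (fun z => phi z 0 j * next_coord z j)).
  by move=> z Oz; rewrite -phi_next// next_neq0.
apply: multiplierM; first exact: phi_multiplier.
rewrite /next_coord; case: insubP => [i _ ij|_]; last first.
  by move=> f; exists f => z _; rewrite mul1r.
apply: IH; rewrite ij; apply: leq_trans njk.
by rewrite ltn_sub2l.
Qed.

Lemma notin_closure_notin_spectrum lam :
  ~ closure (triangle (Pr r)) lam -> ~ taylor_spectrum (Mz H) lam.
Proof.
move=> lamN.
have [j lamj] : exists j, (r j)%:C * `|next_coord lam j| < `|lam 0 j|.
  apply: contrapT => Nex; apply: lamN; apply: le_closure_triangle => // j.
  apply: contrapT => Nle; apply: Nex; exists j; move/negP: Nle.
  by rewrite real_ltNge ?realM ?normr_real ?ger0_real ?ler0c ?(ltW (r_gt0 _)).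
pose a := lam 0 j; pose b := next_coord lam j.
pose h z := (a - b * phi z 0 j)^-1.
have mh : multiplier H h by apply: phi_resolvent_multiplier; rewrite mulrC.
have h1 z : Omega z -> h z * (a - b * phi z 0 j) = 1.
  move=> Oz; rewrite mulVf// subr_eq0; apply: contraTneq lamj => ab.
  rewrite -real_leNgt ?realM ?normr_real ?ger0_real ?ler0c ?(ltW (r_gt0 _))//.
  by rewrite -/a ab normrM mulrC ler_wpM2r// ltW// phi_lt.
(* Since [z_j = phi_j z_(j+1)], these coefficients sum to [h (a - b phi_j) = 1]. For the last [j] no
   index [j.+1] exists, and [b = 1] lets [- h] alone suffice. *)
pose g (i : 'I_n) z := if i == j then - h z else
  if (i == j.+1 :> nat) then h z * phi z 0 j else 0.
apply: (@bezout_not_taylor_spectrum _ _ _ _ _ coord_multiplier_triangle lam g) => [i|z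
  Oz].
  rewrite /g; case: eqP => _.
    by apply: multiplier_ext (multiplierZ (-1) mh) => z _; rewrite mulN1r.
  case: eqP => _; first by apply: multiplierM => //; exact: phi_multiplier.
  by move=> f; exists 0 => z Oz; rewrite -[0 in LHS](scale0r f) fun_ofZ.
rewrite (bigD1 j)//= {1}/g eqxx -[RHS](h1 z Oz).
have zE := phi_next (next_neq0 j Oz).
move: zE; rewrite /b /next_coord; case: insubP => [k _ kj|jn] zE.
  have kneqj : k != j by rewrite -val_eqE kj gtn_eqF.
  rewrite (bigD1 k)//= {1}/g (negbTE kneqj) kj eqxx big1 ?addr0 => [|i /andP[ij ik]].
    by rewrite zE /a; ring.
  rewrite /g (negbTE ij) ifF ?mul0r//; apply: contraNF ik => /eqP ij'.
  by apply/eqP/val_inj; rewrite kj.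
rewrite big1 => [|i ij]; first by rewrite zE /a; ring.
rewrite /g (negbTE ij) ifF ?mul0r//; apply: contraNF jn => /eqP <-.
exact: ltn_ord.
Qed.

Lemma closure_in_spectrum lam :
  closure (triangle (Pr r)) lam -> taylor_spectrum (Mz H) lam.
Proof.
move=> /closure_triangle_le -/(_ r_gt0) lam_le.
have [om om1 [rho [rho0 rhor rholam]]] := triangle_approx r_gt0 lam_le.
pose u k : T := \row_j (om j * (rho k j)%:C).
have Ou k : triangle P (u k) by rewrite triangle_eq_Pr; apply: triangle_polar.
apply: (@approx_taylor_spectrum _ _ _ _ H coord_multiplier_triangle lam u Ou); last first.
  by move=> k i; rewrite mxE.
(* All points share the arguments [om], which cancel in each product of [u k] with the conjugate of
   [u l]; the arguments of the factors are thus positive reals below [s0 j]. *)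
move=> k l; rewrite kernelE.
have om_sq j : om j * Num.conj (om j) = 1 by rewrite -normCK om1 expr1n.
have real_conj (x : R) : Num.conj (x%:C : C) = x%:C by exact: conjc_real.
have nv0 i j : 0 < next_val (rho i) j by rewrite /next_val; case: insub.
have zwE j : u k 0 j * Num.conj (u l 0 j) = (rho k j * rho l j)%:C.
  by rewrite !mxE rmorphM/= real_conj mulrACA om_sq mul1r rmorphM.
have nE j : next_coord (u k) j * Num.conj (next_coord (u l) j) =
    (next_val (rho k) j * next_val (rho l) j)%:C.
  rewrite /next_coord /next_val; case: insub => [i|]; first exact: zwE.
  by rewrite conjC1 !mulr1.
apply: mulr_gt0; apply: prodr_gt0 => j _.
  by rewrite zwE invr_gt0 ltcR mulr_gt0.
have phiE i : phi i 0 j = i 0 j / next_coord i j by rewrite mxE.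
rewrite !phiE rmorphM fmorphV/= mulrACA -invfM zwE nE -fmorphV -rmorphM horner_map/=.
rewrite invr_gt0 exprn_gt0// subr_gt0 ltcR.
rewrite (horner_lt1 (q_ge0 j) (q1 j) (s0_gt0 j) (qs0 j)); last first.
  by rewrite divr_ge0// mulr_ge0// ltW.
rewrite ltr_pdivrMr ?mulr_gt0// -r_sq expr2 mulrACA.
by rewrite ltr_pM// ltW.
Qed.

End TriangleSpectrum.

(** * The radii as square roots of the roots of P_j(s) = 1, and the conclusion *)

Theorem proposition8p5 (R : realType) (n : nat)
    (P : 'I_n -> mpoly.mpoly n R[i]) (m : 'I_n -> nat)
    (A : 'I_n -> nat -> R)
    (H : rkhs (triangle P) (triangle_kernel P m)) :
  (2 <= n)%N ->
  admissible P ->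
  (forall j : 'I_n, (0 < m j)%N) ->
  (forall j : 'I_n,
     power_series_at0 (fun s => (1 - ptilde P j s) ^- m j) (A j)) ->
  exists r : 'I_n -> R,
    [/\ forall j : 'I_n, 0 < r j,
        forall j : 'I_n, ratio_sup (A j) l @[l --> \oo] --> (r j)%:E,
        taylor_spectrum (Mz H) = closure (triangle (Pr r))
      & forall j : 'I_n,
          (r j)%:C <= (sqrtC (peval (mpoly.mderiv j (P j)) 0))^-1].
Proof.
move=> _ admP m_gt0 PA.
have /choice[q qP] := fun j => univariate j admP.
have q_ge0 j i : 0 <= (q j)`_i by have [+ _ _ _ _] := qP j; apply.
have q0 j : (q j)`_0 = 0 by have [_ + _ _ _] := qP j.
have q1 j : 0 < (q j)`_1 by have [_ _ + _ _] := qP j.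
have Pq j z : peval (P j) z = (map_poly (real_complex R) (q j)).[z 0 j].
  by have [_ _ _ + _] := qP j; apply.
have Pd j : peval (mpoly.mderiv j (P j)) 0 = ((q j)`_1)%:C by have [_ _ _ _ +] := qP j.
have /choice[s0 s0P] : forall j, exists s, 0 < s /\ (q j).[s] = 1.
  by move=> j; have [s s_gt0 qs] := horner_eq1_exists (q_ge0 j) (q0 j) (q1 j); exists s.
have s0_gt0 j : 0 < s0 j := (s0P j).1.
have qs0 j : (q j).[s0 j] = 1 := (s0P j).2.
have AE j : A j = inv_pow_coef (q j) (m j).
  apply: power_series_at0_unique (PA j) _.
  have /nbhs_norm0P : exists2 e : R[i], 0 < e & forall s : R[i], `|s| < e ->
      series (fun k => (inv_pow_coef (q j) (m j) k)%:C * s ^+ k) @ \oo -->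
        (1 - ptilde P j s) ^- m j.
    exists (s0 j)%:C; first by rewrite ltcR.
    move=> s ss0; rewrite /ptilde Pq !mxE !eqxx mulr1.
    exact: (inv_pow_coef_series (q_ge0 j) (q0 j) (q1 j) (s0_gt0 j) (qs0 j)).
  exact.
exists (fun j => Num.sqrt (s0 j)); split.
- by move=> j; rewrite sqrtr_gt0.
- move=> j; rewrite AE -(prednK (m_gt0 j)).
  exact: (ratio_sup_inv_pow_coef (q_ge0 j) (q0 j) (q1 j) (s0_gt0 j) (qs0 j)).
- apply/seteqP; split=> lam.
    by apply: contraPP; exact: (notin_closure_notin_spectrum q_ge0 q0 q1 Pq s0_gt0 qs0
      m_gt0).
  exact: (closure_in_spectrum q_ge0 q0 q1 Pq s0_gt0 qs0 m_gt0).
(* Squaring reduces the claim to the linear term of [q j] at [s0 j] being at most [(q j).[s0 j] =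
   1]. *)
move=> j; rewrite Pd -[leRHS]mul1r ler_pdivlMr ?sqrtC_gt0 ?ltcR//.
rewrite -(@expr_le1 _ 2)// ?mulr_ge0 ?sqrtC_ge0 ?ler0c ?sqrtr_ge0 ?(ltW (q1 j))//.
rewrite exprMn sqrtCK -rmorphXn sqr_sqrtr ?(ltW (s0_gt0 j))// -rmorphM lecR.
by rewrite mulrC -(qs0 j); apply: horner_ge_linear (q_ge0 j) (q1 j) _ (ltW (s0_gt0 j)).
Qed.
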